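(* Let $\alpha:\mathbb{Z}_{>0}\to\mathbb{R}_{>0}$ be a monotone function. If there is a polynomial-time $\alpha(\max\{n,m\})$-approximation algorithm for the Pure Fixed Charge Transportation (PFCT) problem (where $n$ and $m$ are the numbers of sources and sinks of the instance), then there is a polynomial-time $\alpha(n)$-approximation algorithm for the Directed Steiner Tree (DST) problem (where $n$ is the number of vertices of the DST instance).
   Context: PFCT: we are given a set $S$ of $n$ sources and a set $T$ of $m$ sinks; each source $i$ has supply $a_i\in\mathbb{Z}_{>0}$, each sink $j$ has demand $b_j\in\mathbb{Z}_{>0}$, with $\sum_{i\in S}a_i=\sum_{j\in T}b_j$; every pair $(i,j)\in S\times T$ has a fixed cost $f_{ij}\ge0$. Feasible solutions are $x\in\mathcal{X}=\{x\in\mathbb{R}_{\ge0}^{S\times T}:\sum_{j}x_{ij}=a_i\ \forall i,\ \sum_i x_{ij}=b_j\ \forall j\}$ and the cost of $x$ is $\sum_{i,j}\mathbf{1}_{x_{ij}>0}f_{ij}$, to be minimized. DST: we are given a directed graph $G=(V,E)$ with $n=|V|$ vertices, a root $r\in V$, a set $T\subseteq V\setminus\{r\}$ of terminals, and edge costs $c_e\ge0$; the goal is to find a minimum-cost subgraph containing a directed path from $r$ to every $t\in T$. An $\alpha$-approximation algorithm outputs a feasible solution of cost at most $\alpha$ times the optimum. *)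

(* Defs.v *)
From HB Require Import structures.
From mathcomp Require Import all_boot all_order all_algebra.
From mathcomp Require Import reals.
Set Implicit Arguments.
Unset Strict Implicit.
Unset Printing Implicit Defensive.
Import Order.TTheory GRing.Theory Num.Theory.

(* Model of computation: structured programs on a random access memory whose
   cells hold natural numbers, under the logarithmic cost criterion.  Evaluating
   an expression costs the total bit length of all values that occur in the
   evaluation, including the addresses that are read; likewise for a write.  A
   computation of cost t hence touches at most t cells and only handles numbers
   of at most t bits, so that the functions computed in polynomial time are the
   same as for Turing machines. *)

(* Length of the binary notation of n; in particular bits 0 = 1. *)
Definition bits (n : nat) : nat := (trunc_log 2 n).+1.

Inductive expr : Type :=
  | Const of nat
  | Read of expr
  | Add of expr & expr
  | Sub of expr & expr
  | Mul of expr & expr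
  | Div of expr & expr.

Inductive prog : Type :=
  | Skip
  | Write of expr & expr
  | Seq of prog & prog
  | If of expr & prog & prog
  | While of expr & prog.

Definition memory := nat -> nat.

(* Sub is truncated subtraction, Div is the Euclidean quotient (0 if the
   divisor is 0). *)
Fixpoint eval (mem : memory) (e : expr) : nat :=
  match e with
  | Const k => k
  | Read a => mem (eval mem a)
  | Add e1 e2 => eval mem e1 + eval mem e2
  | Sub e1 e2 => eval mem e1 - eval mem e2
  | Mul e1 e2 => eval mem e1 * eval mem e2
  | Div e1 e2 => eval mem e1 %/ eval mem e2
  end.

Fixpoint eval_cost (mem : memory) (e : expr) : nat :=
  bits (eval mem e) +
  match e with
  | Const _ => 0
  | Read a => eval_cost mem a
  | Add e1 e2 | Sub e1 e2 | Mul e1 e2 | Div e1 e2 =>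
      eval_cost mem e1 + eval_cost mem e2
  end.

Definition update (mem : memory) (a v : nat) : memory :=
  fun i => if i == a then v else mem i.

(* exec p mem mem' t: started in memory mem, p halts in memory mem' at cost t.
   A condition is true when its value is nonzero. *)
Inductive exec : prog -> memory -> memory -> nat -> Prop :=
  | ExecSkip mem : exec Skip mem mem 1
  | ExecWrite a e mem :
      exec (Write a e) mem (update mem (eval mem a) (eval mem e))
        (eval_cost mem a + eval_cost mem e)
  | ExecSeq p1 p2 mem mem1 mem2 t1 t2 :
      exec p1 mem mem1 t1 -> exec p2 mem1 mem2 t2 ->
      exec (Seq p1 p2) mem mem2 (t1 + t2)
  | ExecIfTrue e p1 p2 mem mem' t :
      eval mem e <> 0 -> exec p1 mem mem' t ->
      exec (If e p1 p2) mem mem' (eval_cost mem e + t)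
  | ExecIfFalse e p1 p2 mem mem' t :
      eval mem e = 0 -> exec p2 mem mem' t ->
      exec (If e p1 p2) mem mem' (eval_cost mem e + t)
  | ExecWhileTrue e p mem mem1 mem2 t1 t2 :
      eval mem e <> 0 -> exec p mem mem1 t1 -> exec (While e p) mem1 mem2 t2 ->
      exec (While e p) mem mem2 (eval_cost mem e + (t1 + t2))
  | ExecWhileFalse e p mem :
      eval mem e = 0 -> exec (While e p) mem mem (eval_cost mem e).

(* Inputs and outputs are sequences of natural numbers: cell 0 holds the length
   and the following cells hold the entries. *)
Definition input_memory (s : seq nat) : memory := nth 0 (size s :: s).

Definition output (mem : memory) : seq nat :=
  mkseq (fun i => mem i.+1) (mem 0).

Definition code_size (s : seq nat) : nat := \sum_(k <- s) bits k.

(* The running time includes the size of the output, which would otherwise be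
   unbounded, as cells that were never written hold 0. *)
Definition runs (p : prog) (s o : seq nat) (t : nat) : Prop :=
  exists mem' t', [/\ exec p (input_memory s) mem' t',
                      o = output mem' & t = t' + code_size o].

Local Open Scope ring_scope.

(* codes_instance and codes_solution are relations because a rational number
   may be written as any fraction, not only in lowest terms. *)
Record min_problem (R : realType) : Type := MinProblem {
  instance : Type;
  solution : instance -> Type;
  feasible : forall I : instance, solution I -> Prop;
  cost : forall I : instance, solution I -> R;
  codes_instance : seq nat -> instance -> Prop;
  codes_solution : forall I : instance, seq nat -> solution I -> Prop }.

Arguments feasible {R} m {I} x.
Arguments cost {R} m {I} x.
Arguments codes_instance {R} m s I.
Arguments codes_solution {R} m {I} s x.

Definition is_optimum (R : realType) (P : min_problem R) (I : instance P)
    (opt : R) : Prop :=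
  (exists x : solution I, feasible P x /\ cost P x = opt) /\
  (forall x : solution I, feasible P x -> opt <= cost P x).

(* On an instance without feasible solutions the algorithm only has to halt
   within the time bound. *)
Definition has_polytime_approximation (R : realType) (P : min_problem R)
    (ratio : instance P -> R) : Prop :=
  exists (p : prog) (c k : nat),
  forall (I : instance P) (s : seq nat), codes_instance P s I ->
  exists (o : seq nat) (t : nat),
  [/\ runs p s o t,
      (t <= c * code_size s ^ k + c)%N &
      (exists y : solution I, feasible P y) ->
      exists x : solution I,
      [/\ codes_solution P o x,
          feasible P x &
          exists2 opt : R, is_optimum I opt & cost P x <= ratio I * opt]].

Definition is_fraction (R : realType) (x : R) (num den : nat) : Prop :=
  (0 < den)%N /\ x = num%:R / den%:R.

Record pfct_instance (R : realType) : Type := PFCTInstance {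
  sources : nat;
  sinks : nat;
  supply : 'I_sources -> nat;
  demand : 'I_sinks -> nat;
  fixed_cost : 'I_sources -> 'I_sinks -> R;
  sources_gt0 : (0 < sources)%N;
  sinks_gt0 : (0 < sinks)%N;
  supply_gt0 : forall i, (0 < supply i)%N;
  demand_gt0 : forall j, (0 < demand j)%N;
  supply_demand : (\sum_i supply i = \sum_j demand j)%N;
  fixed_cost_ge0 : forall i j, 0 <= fixed_cost i j }.

Definition pfct_feasible (R : realType) (I : pfct_instance R)
    (x : 'M[R]_(sources I, sinks I)) : Prop :=
  [/\ forall i j, 0 <= x i j,
      forall i, \sum_j x i j = (supply i)%:R &
      forall j, \sum_i x i j = (demand j)%:R].

Definition pfct_cost (R : realType) (I : pfct_instance R)
    (x : 'M[R]_(sources I, sinks I)) : R :=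
  \sum_i \sum_j (if 0 < x i j then fixed_cost i j else 0).

(* enum lists the indices in increasing order, hence matrices are written row
   by row. *)
Definition pfct_codes_instance (R : realType) (s : seq nat)
    (I : pfct_instance R) : Prop :=
  exists num den : 'I_(sources I) -> 'I_(sinks I) -> nat,
    (forall i j, is_fraction (fixed_cost i j) (num i j) (den i j)) /\
    s = [:: sources I; sinks I]
        ++ [seq supply i | i <- enum 'I_(sources I)]
        ++ [seq demand j | j <- enum 'I_(sinks I)]
        ++ flatten [seq [:: num i j; den i j] | i <- enum 'I_(sources I),
                                                j <- enum 'I_(sinks I)].

Definition pfct_codes_solution (R : realType) (I : pfct_instance R)
    (s : seq nat) (x : 'M[R]_(sources I, sinks I)) : Prop :=
  exists num den : 'I_(sources I) -> 'I_(sinks I) -> nat,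
    (forall i j, is_fraction (x i j) (num i j) (den i j)) /\
    s = flatten [seq [:: num i j; den i j] | i <- enum 'I_(sources I),
                                             j <- enum 'I_(sinks I)].

Definition PFCT (R : realType) : min_problem R :=
  MinProblem (@pfct_feasible R) (@pfct_cost R)
    (@pfct_codes_instance R) (@pfct_codes_solution R).

Record dst_instance (R : realType) : Type := DSTInstance {
  vertices : nat;
  edges : {set 'I_vertices * 'I_vertices};
  root_vertex : 'I_vertices;
  terminals : {set 'I_vertices};
  edge_cost : 'I_vertices * 'I_vertices -> R;
  root_terminals : root_vertex \notin terminals;
  edge_cost_ge0 : forall e, e \in edges -> 0 <= edge_cost e }.

Definition dst_feasible (R : realType) (I : dst_instance R)
    (H : {set 'I_(vertices I) * 'I_(vertices I)}) : Prop :=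
  H \subset edges I /\
  forall t, t \in terminals I ->
    connect (fun u v => (u, v) \in H) (root_vertex I) t.

Definition dst_cost (R : realType) (I : dst_instance R)
    (H : {set 'I_(vertices I) * 'I_(vertices I)}) : R :=
  \sum_(e in H) edge_cost e.

(* Adjacency matrix; each entry is 1 followed by the cost for an edge, and
   0 0 0 for a pair that is not an edge. *)
Definition dst_codes_instance (R : realType) (s : seq nat)
    (I : dst_instance R) : Prop :=
  exists num den : 'I_(vertices I) -> 'I_(vertices I) -> nat,
    (forall u v, (u, v) \in edges I ->
       is_fraction (edge_cost (u, v)) (num u v) (den u v)) /\
    s = [:: vertices I; nat_of_ord (root_vertex I)]
        ++ [seq nat_of_bool (v \in terminals I) | v <- enum 'I_(vertices I)]
        ++ flatten [seq if (u, v) \in edges I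
                        then [:: 1%N; num u v; den u v]
                        else [:: 0%N; 0%N; 0%N]
                   | u <- enum 'I_(vertices I), v <- enum 'I_(vertices I)].

Definition dst_codes_solution (R : realType) (I : dst_instance R)
    (s : seq nat) (H : {set 'I_(vertices I) * 'I_(vertices I)}) : Prop :=
  s = [seq nat_of_bool ((u, v) \in H)
      | u <- enum 'I_(vertices I), v <- enum 'I_(vertices I)].

Definition DST (R : realType) : min_problem R :=
  MinProblem (@dst_feasible R) (@dst_cost R)
    (@dst_codes_instance R) (@dst_codes_solution R).

(* Main.v *)
From mathcomp Require Import all_boot all_order all_algebra.
From mathcomp Require Import reals boolp zify lra.
Require Import Defs.
Set Implicit Arguments.
Unset Strict Implicit.
Unset Printing Implicit Defensive.
Import Order.TTheory GRing.Theory Num.Theory.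

(** Given a DST instance on n vertices with root r and terminals T, take one
    source and one sink per vertex, supply n (plus |T| at r) and demand n (plus 1
    at each terminal).  Shipping from u to u is free, shipping from u to v costs
    c(u, v) if (u, v) is an edge, and otherwise an amount W that is at least the
    total cost of all edges.

    A DST solution yields a transportation of at most the same cost: route one
    unit along a simple path from r to each terminal and ship the rest of each
    supply to the vertex's own sink.  Conversely, a cut argument shows that in the
    support of any feasible transportation all terminals are reachable from r.  If
    the support uses a non-edge then the transportation costs at least W, and the
    whole edge set is a solution that is at least as cheap; otherwise the
    off-diagonal support is one.  In particular W need not depend on alpha, and
    there are exactly n sources and n sinks.

    On the machine, the DST input stays in place, a few variables follow it, and
    the PFCT algorithm runs on a copy of the memory whose base address is relative
    to cell 0.  As the translation only needs branch-free arithmetic, the programs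
    are loops of assignments. *)

(** * Logarithmic costs *)

Lemma bits_lt v : v < 2 ^ bits v.
Proof. by rewrite /bits trunc_log_ltn. Qed.

Lemma bits_gt0 v : 0 < bits v.
Proof. by []. Qed.

Lemma bits_leS v A : v < 2 ^ A.+1 -> bits v <= A.+1.
Proof.
move=> h; rewrite /bits ltnS; case: v h => [|v] h; first by rewrite trunc_log0.
have h2 : 2 ^ trunc_log 2 v.+1 <= v.+1 by apply: trunc_logP.
by have := leq_ltn_trans h2 h; rewrite ltn_exp2l.
Qed.

Lemma bits_le v A : v < 2 ^ A -> bits v <= A.+1.
Proof. by move=> h; apply: bits_leS; apply: leq_trans h _; rewrite leq_exp2l. Qed.

Lemma ltn_pow2D x y A B : x < 2 ^ A -> y < 2 ^ B -> x + y < 2 ^ (A + B).+1.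
Proof.
move=> hx hy; rewrite expnS expnD.
have : 0 < 2 ^ A by rewrite expn_gt0.
have : 0 < 2 ^ B by rewrite expn_gt0.
move: (2 ^ A) (2 ^ B) hx hy => a c; nia.
Qed.

(** Even 0 has one bit, so both powers [2 ^ bits x] and [2 ^ bits y] are at least 2, and the sum of
    two such numbers is at most their product. *)
Lemma bitsD x y : bits (x + y) <= bits x + bits y.
Proof.
have [hx hy] := (bits_lt x, bits_lt y).
apply: (@bits_leS _ (trunc_log 2 x + bits y)).
rewrite (_ : (trunc_log 2 x + bits y).+1 = bits x + bits y) // expnD.
have : 2 <= 2 ^ bits x by rewrite /bits expnS leq_pmulr // expn_gt0.
have : 2 <= 2 ^ bits y by rewrite /bits expnS leq_pmulr // expn_gt0.
move: (2 ^ bits x) (2 ^ bits y) hx hy => a c; nia.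
Qed.

Definition bounded (b : nat) (mem : memory) : Prop := forall a, mem a < 2 ^ b.

Lemma boundedW b b' mem : b <= b' -> bounded b mem -> bounded b' mem.
Proof. by move=> le_b h a; apply: leq_trans (h a) _; rewrite leq_exp2l. Qed.

(* [weight e * b] bounds the bit length of [e] in a memory of [b]-bit numbers. *)
Fixpoint weight (e : expr) : nat :=
  match e with
  | Const k => k
  | Read _ => 1
  | Add e1 e2 | Sub e1 e2 | Mul e1 e2 | Div e1 e2 => (weight e1 + weight e2).+1
  end.

(** Every node is charged [weight] plus 1 times [b]: the extra 1 pays for [bits] exceeding the
    exponent of the bounding power of 2 by one. *)
Fixpoint expr_factor (e : expr) : nat :=
  (weight e).+1 +
  match e with
  | Const _ => 0
  | Read a => expr_factor a
  | Add e1 e2 | Sub e1 e2 | Mul e1 e2 | Div e1 e2 =>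
      expr_factor e1 + expr_factor e2
  end.

(* For a loop this accounts for a single iteration. *)
Fixpoint prog_factor (p : prog) : nat :=
  match p with
  | Skip => 1
  | Write a e => expr_factor a + expr_factor e
  | Seq p1 p2 => prog_factor p1 + prog_factor p2
  | If e p1 p2 => expr_factor e + (prog_factor p1 + prog_factor p2)
  | While e p => expr_factor e + prog_factor p
  end.

Lemma eval_lt b mem e : 0 < b -> bounded b mem -> eval mem e < 2 ^ (weight e * b).
Proof.
move=> b_gt0 hb.
have pow_le A B : A <= B -> 2 ^ A <= 2 ^ B by move=> h; rewrite leq_exp2l.
elim: e => [k|a _|e1 h1 e2 h2|e1 h1 e2 h2|e1 h1 e2 h2|e1 h1 e2 h2] /=.
- by apply: leq_trans (ltn_expl k (ltnSn 1)) (pow_le _ _ _); nia.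
- by rewrite mul1n; apply: hb.
- by apply: leq_trans (ltn_pow2D h1 h2) (pow_le _ _ _); nia.
- apply: leq_trans (leq_ltn_trans (leq_subr _ _) h1) (pow_le _ _ _); nia.
- have := ltn_mul h1 h2; rewrite -expnD => h.
  by apply: leq_trans h (pow_le _ _ _); nia.
- apply: leq_trans (leq_ltn_trans (leq_div _ _) h1) (pow_le _ _ _); nia.
Qed.

Lemma eval_cost_le b mem e : 0 < b -> bounded b mem ->
  eval_cost mem e <= expr_factor e * b.
Proof.
move=> b_gt0 hb.
have hbits e' : bits (eval mem e') <= (weight e').+1 * b.
  apply: leq_trans (bits_le (eval_lt e' b_gt0 hb)) _; nia.
elim: e => [k|a h|e1 h1 e2 h2|e1 h1 e2 h2|e1 h1 e2 h2|e1 h1 e2 h2];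
  rewrite [eval_cost _ _]/= [expr_factor _]/= mulnDl.
- by rewrite leq_add // (hbits (Const k)).
- by rewrite leq_add // (hbits (Read a)).
- by rewrite mulnDl !leq_add // (hbits (Add e1 e2)).
- by rewrite mulnDl !leq_add // (hbits (Sub e1 e2)).
- by rewrite mulnDl !leq_add // (hbits (Mul e1 e2)).
- by rewrite mulnDl !leq_add // (hbits (Div e1 e2)).
Qed.

(** Splits the cost into a constant read off the program text and a budget [B]: the bit bound for a
    single assignment, times the number of guard tests for a loop. Sequencing leaves [B]
    unchanged. *)
Definition exec_within (p : prog) (mem mem' : memory) (B : nat) : Prop :=
  exists2 t, exec p mem mem' t & t <= prog_factor p * B.

Lemma exec_withinW p mem mem' B B' : B <= B' ->
  exec_within p mem mem' B -> exec_within p mem mem' B'.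
Proof.
by move=> le_B [t ex le_t]; exists t => //; apply: leq_trans le_t _; rewrite leq_mul2l le_B orbT.
Qed.

Lemma within_write b mem mem' a e x y : 0 < b -> bounded b mem ->
  eval mem a = x -> eval mem e = y -> update mem x y = mem' ->
  exec_within (Write a e) mem mem' b.
Proof.
move=> b_gt0 hb <- <- <-; exists (eval_cost mem a + eval_cost mem e); first exact: ExecWrite.
by rewrite /= mulnDl leq_add ?eval_cost_le.
Qed.

Lemma within_seq p1 p2 mem mem1 mem2 B :
  exec_within p1 mem mem1 B -> exec_within p2 mem1 mem2 B ->
  exec_within (Seq p1 p2) mem mem2 B.
Proof.
move=> [t1 ex1 le1] [t2 ex2 le2]; exists (t1 + t2); first exact: ExecSeq ex1 ex2.
by rewrite /= mulnDl leq_add.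
Qed.

(** Here [st i] is the memory after [i] iterations. Each guard test and each run of the body costs a
    fixed multiple of [b], and [N] iterations take [N.+1] tests. *)
Lemma within_while (st : nat -> memory) N b B e p : 0 < b ->
  (forall i, i <= N -> bounded b (st i)) ->
  (forall i, i < N -> eval (st i) e <> 0) -> eval (st N) e = 0 ->
  (forall i, i < N -> exec_within p (st i) (st i.+1) b) ->
  N.+1 * b <= B ->
  exec_within (While e p) (st 0) (st N) B.
Proof.
move=> b_gt0 hb hT hF hp le_B.
apply: exec_withinW le_B _.
(* Induction on the number [k] of iterations still to come, because an execution of a loop is
   assembled from its end. *)
suff h k : k <= N -> exec_within (While e p) (st (N - k)) (st N) (k.+1 * b).
  by have := h N (leqnn N); rewrite subnn.
elim: k => [|k IHk] lt_k.
  rewrite subn0; exists (eval_cost (st N) e); first exact: ExecWhileFalse.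
  by apply: leq_trans (eval_cost_le e b_gt0 (hb _ (leqnn _))) _; rewrite /=; nia.
have [t2 ex2 le2] := IHk (ltnW lt_k).
have lt_i : N - k.+1 < N by lia.
have eS : (N - k.+1).+1 = N - k by lia.
have [t1 ex1 le1] := hp _ lt_i; rewrite eS in ex1.
exists (eval_cost (st (N - k.+1)) e + (t1 + t2)).
  by apply: ExecWhileTrue ex1 ex2; apply: hT.
have := eval_cost_le e b_gt0 (hb _ (ltnW lt_i)).
by move: le1 le2 => /=; nia.
Qed.

Lemma bits_eval_le_cost mem e : bits (eval mem e) <= eval_cost mem e.
Proof. by case: e => *; apply: leq_addr. Qed.

(** A written value has no more bits than the cost of evaluating it. This controls the memory left
    behind by an arbitrary PFCT algorithm. *)
Lemma exec_bounded b p mem mem' t : exec p mem mem' t -> bounded b mem ->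
  bounded (b + t) mem'.
Proof.
move=> ex; elim: ex b => {p mem mem' t}.
- by move=> mem b; apply: boundedW; apply: leq_addr.
- move=> a e mem b hb c; rewrite /update; case: eqP => _.
    apply: leq_trans (bits_lt _) _; rewrite leq_exp2l //.
    by have := bits_eval_le_cost mem e; lia.
  by apply: leq_trans (hb c) _; rewrite leq_exp2l // leq_addr.
- by move=> p1 p2 mem mem1 mem2 t1 t2 _ IH1 _ IH2 b hb; rewrite addnA; apply/IH2/IH1.
- move=> e p1 p2 mem mem' t _ _ IH b hb; apply: boundedW (IH b hb); lia.
- move=> e p1 p2 mem mem' t _ _ IH b hb; apply: boundedW (IH b hb); lia.
- move=> e p mem mem1 mem2 t1 t2 _ _ IH1 _ IH2 b hb.
  by apply: boundedW (IH2 _ (IH1 _ hb)); lia.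
- by move=> e p mem _ b; apply: boundedW; apply: leq_addr.
Qed.

(** * Running a program on a copy of the memory *)

(* Cells 0 .. L hold [f], where [f 0 = L]; the next five cells
   hold the variables [vs]; the remaining ones are a copy of the memory [g]. *)
Definition layout (L : nat) (f : memory) (vs : seq nat) (g : memory) : memory :=
  fun a => if a <= L then f a
           else if a <= L + 5 then nth 0 vs (a - L.+1) else g (a - (L + 6)).

(** Cell 0 holds [L], so fixed programs can find the variables in cells [L + 1] to [L + 5] and the
    copy from cell [L + 6] on. *)
Definition var_addr (j : nat) : expr := Add (Read (Const 0)) (Const j.+1).
Definition var (j : nat) : expr := Read (var_addr j).
Definition copy_addr (e : expr) : expr := Add (Add (Read (Const 0)) (Const 6)) e.

Section Layout.
Variables (L : nat) (f : memory).

Lemma layout_low vs g a : a <= L -> layout L f vs g a = f a.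
Proof. by rewrite /layout => ->. Qed.

Lemma layout_var vs g j : j < 5 -> layout L f vs g (L + j.+1) = nth 0 vs j.
Proof.
move=> hj; rewrite /layout; case: ifP => [|_]; first by lia.
by case: ifP => [_|]; [congr nth; lia | lia].
Qed.

Lemma layout_copy vs g a : layout L f vs g (L + 6 + a) = g a.
Proof.
rewrite /layout; case: ifP => [|_]; first by lia.
by case: ifP => [|_]; [lia | congr g; lia].
Qed.

Lemma update_layout_low vs g a y : a <= L ->
  update (layout L f vs g) a y = layout L (update f a y) vs g.
Proof.
move=> ha; apply: funext => c; rewrite /update /layout.
by case: eqP => [->|//]; rewrite ha.
Qed.

Lemma update_layout_var vs g j y : j < 5 ->
  update (layout L f vs g) (L + j.+1) y = layout L f (set_nth 0 vs j y) g.
Proof.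
move=> hj; apply: funext => c; rewrite /update /layout nth_set_nth /=.
case: eqP => [->|ne].
  have -> : (L + j.+1 <= L) = false by lia.
  have -> : L + j.+1 <= L + 5 by lia.
  have -> : L + j.+1 - L.+1 = j by lia.
  by rewrite eqxx.
case: ifP => // h1; case: ifP => // h2.
by case: eqP => // e; lia.
Qed.

Lemma update_layout_copy vs g a y :
  update (layout L f vs g) (L + 6 + a) y = layout L f vs (update g a y).
Proof.
apply: funext => c; rewrite /update /layout.
case: eqP => [->|ne].
  have -> : (L + 6 + a <= L) = false by lia.
  have -> : (L + 6 + a <= L + 5) = false by lia.
  have -> : L + 6 + a - (L + 6) = a by lia.
  by rewrite eqxx.
case: ifP => // h1; case: ifP => // h2.
by case: eqP => // e; lia.
Qed.

Lemma bounded_layout b vs g : bounded b f -> all (fun v => v < 2 ^ b) vs ->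
  bounded b g -> bounded b (layout L f vs g).
Proof.
move=> hf hvs hg a; rewrite /layout; case: ifP => // _; case: ifP => // _.
have [h|h] := ltnP (a - L.+1) (size vs); first exact: (all_nthP 0 hvs).
by rewrite nth_default // expn_gt0.
Qed.

Hypothesis f0 : f 0 = L.

Lemma layout0 vs g : layout L f vs g 0 = L.
Proof. by rewrite layout_low. Qed.

Lemma eval_var_addr vs g j : eval (layout L f vs g) (var_addr j) = L + j.+1.
Proof. by rewrite /= layout0. Qed.

Lemma eval_var vs g j : j < 5 -> eval (layout L f vs g) (var j) = nth 0 vs j.
Proof. by move=> hj; rewrite -(layout_var vs g) //= layout0. Qed.

Lemma eval_copy_addr vs g e : 
  eval (layout L f vs g) (copy_addr e) = L + 6 + eval (layout L f vs g) e.
Proof. by rewrite /= layout0. Qed.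

End Layout.

Fixpoint reloc_expr (e : expr) : expr :=
  match e with
  | Const k => Const k
  | Read a => Read (copy_addr (reloc_expr a))
  | Add e1 e2 => Add (reloc_expr e1) (reloc_expr e2)
  | Sub e1 e2 => Sub (reloc_expr e1) (reloc_expr e2)
  | Mul e1 e2 => Mul (reloc_expr e1) (reloc_expr e2)
  | Div e1 e2 => Div (reloc_expr e1) (reloc_expr e2)
  end.

Fixpoint reloc (p : prog) : prog :=
  match p with
  | Skip => Skip
  | Write a e => Write (copy_addr (reloc_expr a)) (reloc_expr e)
  | Seq p1 p2 => Seq (reloc p1) (reloc p2)
  | If e p1 p2 => If (reloc_expr e) (reloc p1) (reloc p2)
  | While e p => While (reloc_expr e) (reloc p)
  end.

Section Relocation.
Variables (L : nat) (f : memory) (vs : seq nat).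
Hypothesis f0 : f 0 = L.

Local Notation lay := (layout L f vs).

Lemma eval_reloc g e : eval (lay g) (reloc_expr e) = eval g e.
Proof.
elim: e => [k|a IH|e1 h1 e2 h2|e1 h1 e2 h2|e1 h1 e2 h2|e1 h1 e2 h2] //=;
  try by rewrite h1 h2.
by rewrite layout0 // IH layout_copy.
Qed.

(** Cost of shifting an address by [L + 6]. The term [bits (L + 6)] counts twice: once for that
    value, once for its share in the bit length of the shifted address, by [bitsD]. *)
Definition addr_overhead : nat := 2 * bits (L + 6) + bits L + bits 0 + bits 6.

Lemma eval_cost_copy_addr g e :
  eval_cost (lay g) (copy_addr (reloc_expr e)) <=
  bits (eval g e) + addr_overhead + eval_cost (lay g) (reloc_expr e).
Proof.
rewrite /= layout0 // eval_reloc /addr_overhead.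
by have := bitsD (L + 6) (eval g e); lia.
Qed.

(* The summand [bits (eval g e)] pays for the address when [e] is dereferenced. *)
Lemma eval_cost_reloc g e :
  eval_cost (lay g) (reloc_expr e) + bits (eval g e) <=
  (addr_overhead + 2) * eval_cost g e.
Proof.
have bin v c1 c2 c1' c2' : c1' <= (addr_overhead + 2) * c1 ->
    c2' <= (addr_overhead + 2) * c2 ->
    bits v + (c1' + c2') + bits v <= (addr_overhead + 2) * (bits v + (c1 + c2)).
  by nia.
have le e' : eval_cost (lay g) (reloc_expr e') + bits (eval g e') <=
    (addr_overhead + 2) * eval_cost g e' ->
    eval_cost (lay g) (reloc_expr e') <= (addr_overhead + 2) * eval_cost g e'.
  by apply: leq_trans; apply: leq_addr.
elim: e => [k|a IH|e1 h1 e2 h2|e1 h1 e2 h2|e1 h1 e2 h2|e1 h1 e2 h2] /=;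
  rewrite ?eval_reloc; try by apply: bin; apply: le.
- by rewrite addn0; nia.
- have := eval_cost_copy_addr g a; rewrite /= layout0 // eval_reloc layout_copy.
  by have := bits_gt0 (g (eval g a)); nia.
Qed.

Lemma exec_reloc p g g' t : exec p g g' t ->
  exists2 t', exec (reloc p) (lay g) (lay g') t' & t' <= 2 * (addr_overhead + 2) * t.
Proof.
set M := addr_overhead + 2.
have hM mem e : eval_cost (lay mem) (reloc_expr e) <= 2 * M * eval_cost mem e.
  by have := eval_cost_reloc mem e; rewrite -/M; nia.
elim=> {p g g' t}.
- by move=> g; exists 1; [apply: ExecSkip | rewrite /M; lia].
- move=> a e g; exists (eval_cost (lay g) (copy_addr (reloc_expr a)) +
                        eval_cost (lay g) (reloc_expr e)).
    have -> : lay (update g (eval g a) (eval g e)) =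
        update (lay g) (eval (lay g) (copy_addr (reloc_expr a))) (eval (lay g) (reloc_expr e)).
      by rewrite eval_copy_addr // !eval_reloc update_layout_copy.
    exact: ExecWrite.
  (* The target address of a write is shifted as well. As its evaluation costs at least 1, the
     second overhead is absorbed by the factor 2. *)
  have h1 := eval_cost_copy_addr g a; have h2 := eval_cost_reloc g a.
  have := hM g e; have := leq_trans (bits_gt0 _) (bits_eval_le_cost g a).
  rewrite -/M in h2; rewrite /M in h1 h2 *; nia.
- move=> p1 p2 g g1 g2 t1 t2 _ [t1' ex1 le1] _ [t2' ex2 le2].
  by exists (t1' + t2'); [apply: ExecSeq ex1 ex2 | rewrite mulnDr leq_add].
- move=> e p1 p2 g g' t ne _ [t' ex le]; exists (eval_cost (lay g) (reloc_expr e) + t').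
    by apply: ExecIfTrue => //; rewrite eval_reloc.
  by rewrite mulnDr leq_add.
- move=> e p1 p2 g g' t ne _ [t' ex le]; exists (eval_cost (lay g) (reloc_expr e) + t').
    by apply: ExecIfFalse => //; rewrite eval_reloc.
  by rewrite mulnDr leq_add.
- move=> e p g g1 g2 t1 t2 ne _ [t1' ex1 le1] _ [t2' ex2 le2].
  exists (eval_cost (lay g) (reloc_expr e) + (t1' + t2')).
    by apply: ExecWhileTrue ex1 ex2; rewrite eval_reloc.
  by have := hM g e; nia.
- move=> e p g e0; exists (eval_cost (lay g) (reloc_expr e)) => //.
  by apply: ExecWhileFalse; rewrite eval_reloc.
Qed.

End Relocation.

(** * Polynomial bounds *)

Definition poly_bounded (f : nat -> nat) : Prop :=
  exists c k, forall x, f x <= c * x ^ k + c.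

(** The summand 1 covers [x = 0], [k = 0], where the left side is 1 while the right power may
    vanish. *)
Lemma leq_pow_add1 x k l : k <= l -> x ^ k <= x ^ l + 1.
Proof.
case: x => [|x] le_kl; last by apply: leq_trans (leq_addr _ _); rewrite leq_pexp2l.
by case: k le_kl => [|k] le_kl; rewrite ?expn0 ?leq_addl // exp0n.
Qed.

Lemma poly_bounded_const c : poly_bounded (fun=> c).
Proof. by exists c, 0 => x; rewrite leq_addl. Qed.

Lemma poly_bounded_id : poly_bounded (fun x => x).
Proof. by exists 1, 1 => x; rewrite expn1; lia. Qed.

Lemma poly_boundedD f g : poly_bounded f -> poly_bounded g ->
  poly_bounded (fun x => f x + g x).
Proof.
move=> [c [k hf]] [d [l hg]]; exists (2 * (c + d)), (k + l) => x.
have := hf x; have := hg x.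
have := leq_pow_add1 x (leq_addr l k); have := leq_pow_add1 x (leq_addl k l).
by move: (x ^ k) (x ^ l) (x ^ (k + l)) => u v w; nia.
Qed.

Lemma poly_boundedM f g : poly_bounded f -> poly_bounded g ->
  poly_bounded (fun x => f x * g x).
Proof.
move=> [c [k hf]] [d [l hg]]; exists (3 * (c * d)), (k + l) => x.
apply: leq_trans (leq_mul (hf x) (hg x)) _.
have := leq_pow_add1 x (leq_addr l k); have := leq_pow_add1 x (leq_addl k l).
rewrite expnD; move: (x ^ k) (x ^ l) => u v h1 h2.
have -> : (c * u + c) * (d * v + d) = c * d * (u * v + u + v + 1) by lia.
have -> : 3 * (c * d) * (u * v) + 3 * (c * d) = c * d * (3 * (u * v) + 3) by lia.
by rewrite leq_mul2l; apply/orP; right; lia.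
Qed.

Lemma poly_boundedX f k : poly_bounded f -> poly_bounded (fun x => f x ^ k).
Proof.
move=> hf; elim: k => [|k IHk]; first exact: (poly_bounded_const 1).
by have [c [l h]] := poly_boundedM hf IHk; exists c, l => x; rewrite expnS.
Qed.

(** * The translation programs *)

Lemma size_flatten_mkseq (T : Type) (F : nat -> seq T) d m :
  (forall k, size (F k) = d) -> size (flatten (mkseq F m)) = m * d.
Proof.
move=> hF; elim: m => [|m IHm] //.
by rewrite mkseqS flatten_rcons size_cat IHm hF mulSn addnC.
Qed.

Lemma nth_flatten_mkseq (T : Type) (x0 : T) (F : nat -> seq T) d m k j :
  (forall i, size (F i) = d) -> k < m -> j < d ->
  nth x0 (flatten (mkseq F m)) (k * d + j) = nth x0 (F k) j.
Proof.
move=> hF lt_k lt_j; elim: m lt_k => [|m IHm] // lt_k.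
rewrite mkseqS flatten_rcons nth_cat (size_flatten_mkseq m hF).
have [lt_km|le_mk] := ltnP k m.
  have -> : k * d + j < m * d by nia.
  by apply: IHm.
have -> : k = m by lia.
have -> : (m * d + j < m * d) = false by lia.
by rewrite addKn.
Qed.

(** The codes as the machine sees them: the pair (u, v) becomes the single index [k = u * n + v],
    and the entries are given by functions on all of [nat]. *)
Definition dst_code (n r : nat) (tf fl nm dn : nat -> nat) : seq nat :=
  [:: n; r] ++ mkseq tf n ++ flatten (mkseq (fun k => [:: fl k; nm k; dn k]) (n * n)).

Definition pfct_code (n : nat) (sup dem cn cd : nat -> nat) : seq nat :=
  [:: n; n] ++ mkseq sup n ++ mkseq dem n ++
  flatten (mkseq (fun k => [:: cn k; cd k]) (n * n)).

Section DstCode.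
Variables (n r : nat) (tf fl nm dn : nat -> nat).
Local Notation s := (dst_code n r tf fl nm dn).

Lemma size_dst_code : size s = 2 + n + 3 * (n * n).
Proof. by rewrite /= size_cat size_mkseq (@size_flatten_mkseq _ _ 3) //; lia. Qed.

Lemma dst_code_flag i : i < n -> input_memory s (3 + i) = tf i.
Proof. by move=> hi; rewrite /input_memory /= nth_cat size_mkseq hi nth_mkseq. Qed.

(** Cells 0, 1, 2 hold the length, [n] and the root; [n] terminal flags follow, then three cells for
    each pair. *)
Lemma dst_code_entry k d : k < n * n -> d < 3 ->
  input_memory s (3 + d + n + 3 * k) = nth 0 [:: fl k; nm k; dn k] d.
Proof.
move=> hk hd; have -> : 3 + d + n + 3 * k = (n + (k * 3 + d)).+3 by lia.
rewrite /input_memory /= nth_cat size_mkseq ltnNge leq_addr /= addKn.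
by rewrite (@nth_flatten_mkseq _ 0 (fun k => [:: fl k; nm k; dn k]) 3).
Qed.
End DstCode.

Section PfctCode.
Variables (n : nat) (sup dem cn cd : nat -> nat).
Local Notation s := (pfct_code n sup dem cn cd).

Lemma size_pfct_code : size s = 2 + 2 * n + 2 * (n * n).
Proof. by rewrite /= !size_cat !size_mkseq (@size_flatten_mkseq _ _ 2) //; lia. Qed.

Lemma pfct_code_supply i : i < n -> input_memory s (3 + i) = sup i.
Proof. by move=> hi; rewrite /input_memory /= nth_cat size_mkseq hi nth_mkseq. Qed.

Lemma pfct_code_demand i : i < n -> input_memory s (3 + n + i) = dem i.
Proof.
move=> hi; rewrite /input_memory /= nth_cat size_mkseq ltnNge leq_addr /= addKn.
by rewrite nth_cat size_mkseq hi nth_mkseq.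
Qed.

Lemma pfct_code_entry k d : k < n * n -> d < 2 ->
  input_memory s (3 + 2 * n + 2 * k + d) = nth 0 [:: cn k; cd k] d.
Proof.
move=> hk hd; have -> : 3 + 2 * n + 2 * k + d = (n + (n + (k * 2 + d))).+3 by lia.
rewrite /input_memory /= nth_cat size_mkseq ltnNge leq_addr /= addKn.
rewrite nth_cat size_mkseq ltnNge leq_addr /= addKn.
by rewrite (@nth_flatten_mkseq _ 0 (fun k => [:: cn k; cd k]) 2).
Qed.
End PfctCode.

Lemma bounded_input b s : size s < 2 ^ b -> all (fun v => v < 2 ^ b) s ->
  bounded b (input_memory s).
Proof.
move=> hs hall a; rewrite /input_memory; case: a => [|a] //=.
have [h|h] := ltnP a (size s); first exact: (all_nthP 0 hall).
by rewrite nth_default // expn_gt0.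
Qed.

Lemma all_pfct_code (P : pred nat) n sup dem cn cd : P n ->
  (forall i, i < n -> P (sup i)) -> (forall i, i < n -> P (dem i)) ->
  (forall k, k < n * n -> P (cn k)) -> (forall k, k < n * n -> P (cd k)) ->
  all P (pfct_code n sup dem cn cd).
Proof.
move=> hn hs hd hcn hcd; rewrite /= hn !all_cat /=; apply/and3P; split.
- by rewrite all_map; apply/allP => i; rewrite mem_iota => /andP[_]; apply: hs.
- by rewrite all_map; apply/allP => i; rewrite mem_iota => /andP[_]; apply: hd.
- apply/allP => x /flattenP[y /mapP[k]]; rewrite mem_iota => /andP[_ hk] ->.
  by rewrite !inE => /orP[] /eqP->; [apply: hcn | apply: hcd].
Qed.

(* The variables hold n, the loop counter or write position, the number of
   terminals, the cost of non-edges and the number of non-edges in use. *)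
Definition nvar : expr := var 0.
Definition ivar : expr := var 1.
Definition cvar : expr := var 2.
Definition fvar : expr := var 3.
Definition bvar : expr := var 4.

(** With truncated subtraction this is the 0-1 indicator of a nonzero value; in [differ] one of the
    two differences is always 0. Such indicators replace branching. *)
Definition positive (e : expr) : expr := Sub (Const 1) (Sub (Const 1) e).
Definition differ (e1 e2 : expr) : expr := positive (Add (Sub e1 e2) (Sub e2 e1)).
Definition off_diag (k : expr) : expr :=
  differ (Div k nvar) (Sub k (Mul (Div k nvar) nvar)).

Definition entry (d : nat) (k : expr) : expr :=
  Read (Add (Add (Const (3 + d)) nvar) (Mul (Const 3) k)).

Definition incr : prog := Write (var_addr 1) (Add ivar (Const 1)).
Definition push (e : expr) : prog := Seq (Write (copy_addr ivar) e) incr.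

Definition count_loop : prog :=
  While (Sub nvar ivar)
    (Seq (Write (var_addr 2) (Add cvar (Read (Add (Const 3) ivar)))) incr).

Definition sum_loop : prog :=
  While (Sub (Mul nvar nvar) ivar)
    (Seq (Write (var_addr 3) (Add fvar (entry 1 ivar))) incr).

Definition reset : prog := Write (var_addr 1) (Const 0).

Definition supply_end : expr := Add (Const 3) nvar.
Definition demand_end : expr := Add (Const 3) (Mul (Const 2) nvar).
Definition cost_end : expr := Add demand_end (Mul (Const 2) (Mul nvar nvar)).

(** At write position [i] the vertex is [i - 3], and cell 2 of the input holds the root. *)
Definition supply_expr : expr :=
  Add nvar (Mul (Sub (Const 1) (differ (Sub ivar (Const 3)) (Read (Const 2)))) cvar).
(** The demand of vertex [j] goes to cell [3 + n + j] of the copy and its flag sits in cell [3 + j]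
    of the input, exactly [n] cells lower. *)
Definition demand_expr : expr := Add nvar (Read (Sub ivar nvar)).

(** Rounding down yields the same pair index for the numerator and the denominator position. *)
Definition cost_index : expr := Div (Sub ivar demand_end) (Const 2).
Definition num_expr : expr :=
  Mul (off_diag cost_index)
    (Add (entry 1 cost_index) (Mul (Sub (Const 1) (entry 0 cost_index)) fvar)).
(** The second summand supplies the denominator 1 on the diagonal and at non-edges, whose costs are
    the integers 0 and [fvar]. *)
Definition den_expr : expr :=
  Add (Mul (off_diag cost_index) (entry 2 cost_index))
    (Sub (Const 1) (Mul (off_diag cost_index) (entry 0 cost_index))).

(** [cost_end] is the first cell after the code; subtracting cell 0 gives the length to be stored
    there. *)
Definition header : prog :=
  Seq (push (Sub cost_end (Const 1))) (Seq (push nvar) (push nvar)).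
Definition supply_loop : prog := While (Sub supply_end ivar) (push supply_expr).
Definition demand_loop : prog := While (Sub demand_end ivar) (push demand_expr).
Definition cost_loop : prog :=
  While (Sub cost_end ivar) (Seq (push num_expr) (push den_expr)).

Definition build : prog :=
  Seq (Write (var_addr 0) (Read (Const 1)))
  (Seq count_loop (Seq reset (Seq sum_loop (Seq reset
  (Seq header (Seq supply_loop (Seq demand_loop cost_loop))))))).

(** The numerator of the shipped amount. As denominators are positive, it alone decides whether the
    amount is positive. *)
Definition flow : expr := Read (copy_addr (Add (Const 1) (Mul (Const 2) ivar))).
Definition used : expr := Mul (off_diag ivar) (positive flow).

Definition virtual_loop : prog :=
  While (Sub (Mul nvar nvar) ivar)
    (Seq (Write (var_addr 4) (Add bvar (Mul (Sub (Const 1) (entry 0 ivar)) used))) incr).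
Definition select_loop : prog :=
  While (Sub (Mul nvar nvar) ivar)
    (Seq (Write (Add (Const 1) ivar) (Mul (entry 0 ivar) (positive (Add bvar used)))) incr).

Definition extract : prog :=
  Seq reset (Seq virtual_loop (Seq reset (Seq select_loop
    (Write (Const 0) (Mul nvar nvar))))).

(** * Execution and cost of the loops *)

Lemma within_set L f vs g b j e y : f 0 = L -> 0 < b -> bounded b (layout L f vs g) ->
  j < 5 -> eval (layout L f vs g) e = y ->
  exec_within (Write (var_addr j) e) (layout L f vs g) (layout L f (set_nth 0 vs j y) g) b.
Proof.
move=> f0 b_gt0 hb hj ee; apply: (within_write b_gt0 hb (eval_var_addr f0 _ _ j) ee).
by rewrite update_layout_var.
Qed.

Lemma evalD m e1 e2 : eval m (Add e1 e2) = eval m e1 + eval m e2. Proof. by []. Qed.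
Lemma evalB m e1 e2 : eval m (Sub e1 e2) = eval m e1 - eval m e2. Proof. by []. Qed.
Lemma evalM m e1 e2 : eval m (Mul e1 e2) = eval m e1 * eval m e2. Proof. by []. Qed.
Lemma evalV m e1 e2 : eval m (Div e1 e2) = eval m e1 %/ eval m e2. Proof. by []. Qed.
Lemma evalC m k : eval m (Const k) = k. Proof. by []. Qed.
Definition evalE := (evalD, evalB, evalM, evalV, evalC).

Section Eval.
Variables (L : nat) (f : memory) (n i c F d : nat) (g : memory).
Hypothesis f0 : f 0 = L.
Local Notation m := (layout L f [:: n; i; c; F; d] g).

Lemma eval_nvar : eval m nvar = n. Proof. by rewrite /nvar (eval_var f0). Qed.
Lemma eval_ivar : eval m ivar = i. Proof. by rewrite /ivar (eval_var f0). Qed.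
Lemma eval_cvar : eval m cvar = c. Proof. by rewrite /cvar (eval_var f0). Qed.
Lemma eval_fvar : eval m fvar = F. Proof. by rewrite /fvar (eval_var f0). Qed.
Lemma eval_bvar : eval m bvar = d. Proof. by rewrite /bvar (eval_var f0). Qed.
Definition eval_vars := (eval_nvar, eval_ivar, eval_cvar, eval_fvar, eval_bvar).

Lemma eval_read_low e a : eval m e = a -> a <= L -> eval m (Read e) = f a.
Proof. by move=> <- h; rewrite -(layout_low _ [:: n; i; c; F; d] g h). Qed.

Lemma eval_off_diag e k : eval m e = k ->
  eval m (off_diag e) = (k %/ n != k %% n).
Proof.
move=> ek; rewrite /off_diag /differ /positive !evalE eval_nvar ek.
have := divn_eq k n; move: (k %/ n) (k %% n) => q x ->.
by rewrite addKn; case: eqP; lia.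
Qed.

Lemma eval_entry e k x : eval m e = k -> 3 + x + n + 3 * k <= L ->
  eval m (entry x e) = f (3 + x + n + 3 * k).
Proof.
by move=> ek; apply: eval_read_low; rewrite !evalE eval_nvar ek.
Qed.

Lemma within_incr b : 0 < b -> bounded b m ->
  exec_within incr m (layout L f [:: n; i.+1; c; F; d] g) b.
Proof.
move=> b_gt0 hb; apply: (within_set f0 b_gt0 hb (isT : 1 < 5)).
by rewrite !evalE eval_ivar addn1.
Qed.

Lemma within_reset b : 0 < b -> bounded b m ->
  exec_within reset m (layout L f [:: n; 0; c; F; d] g) b.
Proof.
by move=> b_gt0 hb; apply: (within_set f0 b_gt0 hb (isT : 1 < 5)).
Qed.

End Eval.

Section Programs.
Variables (n r : nat) (tf fl nm dn : nat -> nat) (b1 : nat).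
Hypothesis r_lt : r < n.
Hypothesis tf_le1 : forall i, tf i <= 1.
Hypothesis fl_le1 : forall k, fl k <= 1.

Definition terminal_count : nat := \sum_(0 <= i < n) tf i.
Definition num_sum : nat := \sum_(0 <= k < n * n) nm k.
Definition pfct_supply (i : nat) : nat := n + (i == r) * terminal_count.
Definition pfct_demand (j : nat) : nat := n + tf j.
Definition pfct_num (k : nat) : nat :=
  (k %/ n != k %% n) * (nm k + (1 - fl k) * num_sum).
Definition pfct_den (k : nat) : nat :=
  (k %/ n != k %% n) * dn k + (1 - (k %/ n != k %% n) * fl k).

Definition reduction_code : seq nat :=
  pfct_code n pfct_supply pfct_demand pfct_num pfct_den.

Local Notation s := (dst_code n r tf fl nm dn).
Local Notation m0 := (input_memory s).
Local Notation L := (size s).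
Local Notation tgt := (input_memory reduction_code).
Local Notation B := (2 ^ b1).
(** The largest value that arises is a numerator plus the sum of all numerators. The latter is below
    [B * B], since it has [n * n < B] terms below [B]; two spare bits cover the rest. *)
Local Notation b := (2 * b1 + 2).

Hypothesis m0_bounded : bounded b1 m0.

Let LE : L = 2 + n + 3 * (n * n). Proof. exact: size_dst_code. Qed.
Let n_gt0 : 0 < n. Proof. exact: leq_ltn_trans r_lt. Qed.
Let n_le : n <= n * n. Proof. by rewrite leq_pmulr. Qed.
Let L_lt : L < B. Proof. exact: (m0_bounded 0). Qed.
Let pow_b : 2 ^ b = 4 * (B * B). Proof. by rewrite expnD mulnC mul2n -addnn expnD. Qed.
Let b_gt0 : 0 < b. Proof. by rewrite addn2. Qed.
Let lt_b v : v < 4 * B -> v < 2 ^ b.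
Proof. by rewrite pow_b; have := L_lt; move: B => x; nia. Qed.
Let nm_lt k : k < n * n -> nm k < B.
Proof. move=> hk; have <- : _ = nm k := @dst_code_entry n r tf fl nm dn k 1 hk isT.
exact: m0_bounded. Qed.
Let dn_lt k : k < n * n -> dn k < B.
Proof. move=> hk; have <- : _ = dn k := @dst_code_entry n r tf fl nm dn k 2 hk isT.
exact: m0_bounded. Qed.

Lemma partial_count_le i : \sum_(0 <= j < i) tf j <= i.
Proof.
rewrite -[X in _ <= X]muln1 -[i in X in _ <= X]subn0 -sum_nat_const_nat.
exact: leq_sum.
Qed.

Lemma partial_sum_le i : i <= n * n -> \sum_(0 <= k < i) nm k <= i * B.
Proof.
elim: i => [|i IHi] hi; first by rewrite big_geq.
by rewrite big_nat_recr //= mulSn addnC leq_add ?IHi ?(ltnW (nm_lt hi)) // ltnW.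
Qed.

Let m0_bounded' : bounded b m0. Proof. by apply: boundedW m0_bounded; lia. Qed.

Let partial_sum_lt i : i <= n * n -> \sum_(0 <= k < i) nm k < B * B.
Proof.
move=> hi; have := partial_sum_le hi; have := L_lt; have := LE.
by move: (\sum_(_ <= _ < _) _) B => x y; nia.
Qed.

Let low_bounded i c F d g : i < 4 * B -> c < 4 * B -> F < 4 * (B * B) -> d < 4 * B ->
  bounded b g -> bounded b (layout L m0 [:: n; i; c; F; d] g).
Proof.
move=> hi hc hF hd hg; apply: bounded_layout => //=.
rewrite (lt_b hi) (lt_b hc) (lt_b hd) pow_b hF -pow_b lt_b //.
by have := L_lt; have := LE; lia.
Qed.

Let zero_bounded : bounded b (fun=> 0). Proof. by move=> a; rewrite expn_gt0. Qed.

Lemma reduction_code_bounded : bounded b tgt.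
Proof.
have hL := L_lt; have hE := LE.
apply: bounded_input.
  by apply: lt_b; rewrite size_pfct_code; lia.
apply: all_pfct_code => [|i hi|i hi|k hk|k hk].
- by apply: lt_b; lia.
- apply: lt_b; rewrite /pfct_supply; have := partial_count_le n.
  by rewrite -/terminal_count; case: eqP; lia.
- by apply: lt_b; rewrite /pfct_demand; have := tf_le1 i; lia.
- rewrite pow_b /pfct_num; have := nm_lt hk.
  have := partial_sum_lt (leqnn _); rewrite -/num_sum.
  move: B hL => x; case: (_ != _); have := fl_le1 k.
    by move: (nm k) (fl k) num_sum => u v w; nia.
  by nia.
- by apply: lt_b; rewrite /pfct_den; have := dn_lt hk; case: (_ != _); lia.
Qed.

(** The part of the target written so far. In [St i] the write position is [i] as well, which is the
    common invariant of all loops that push. *)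
Let pref i : memory := fun a => if a < i then tgt a else 0.

Let pref_bounded i : bounded b (pref i).
Proof. by move=> a; rewrite /pref; case: ifP => _; rewrite ?expn_gt0 ?reduction_code_bounded. Qed.

Local Notation St i := (layout L m0 [:: n; i; terminal_count; num_sum; 0] (pref i)).

Let St_bounded i : i <= 3 + 2 * n + 2 * (n * n) -> bounded b (St i).
Proof.
move=> hi; have hL := L_lt; have hE := LE; have hc := partial_count_le n.
apply: low_bounded => //; rewrite ?/terminal_count; try lia.
by have := partial_sum_lt (leqnn _); rewrite -/num_sum; lia.
Qed.

Lemma within_push i e : i < 3 + 2 * n + 2 * (n * n) -> eval (St i) e = tgt i ->
  exec_within (push e) (St i) (St i.+1) b.
Proof.
move=> hi ee; have m00 : m0 0 = L by [].
set St' := layout L m0 [:: n; i; terminal_count; num_sum; 0] (pref i.+1).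
apply: (@within_seq _ _ _ St').
  apply: (within_write b_gt0 (St_bounded (ltnW hi)) (erefl _) ee).
  rewrite (eval_copy_addr m00) (eval_ivar _ _ _ _ _ _ m00) update_layout_copy.
  congr layout; apply: funext => a; rewrite /update /pref ltnS.
  by case: eqP => [->|ne]; rewrite ?leqnn //; have -> : (a < i) = (a <= i) by lia.
apply: (within_incr m00) => //.
have hL := L_lt; have hE := LE; apply: low_bounded => //; try lia.
- by have := partial_count_le n; rewrite -/terminal_count; lia.
- by have := partial_sum_lt (leqnn _); rewrite -/num_sum; lia.
Qed.

Let m00 : m0 0 = L. Proof. by []. Qed.

Lemma within_count_loop B' : L.+2 * b <= B' ->
  exec_within count_loop (layout L m0 [:: n; 0; 0; 0; 0] (fun=> 0))
    (layout L m0 [:: n; n; terminal_count; 0; 0] (fun=> 0)) B'.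
Proof.
move=> hB; have hL := L_lt; have hE := LE.
pose st i := layout L m0 [:: n; i; \sum_(0 <= j < i) tf j; 0; 0] (fun=> 0).
have -> : layout L m0 [:: n; 0; 0; 0; 0] (fun=> 0) = st 0 by rewrite /st big_geq.
have bst i c : i <= n -> c <= n -> bounded b (layout L m0 [:: n; i; c; 0; 0] (fun=> 0)).
  by move=> hi hc; apply: low_bounded => //; move: B hL => x; nia.
have pc i : i <= n -> \sum_(0 <= j < i) tf j <= n.
  by apply: leq_trans; apply: partial_count_le.
apply: (@within_while st n b) => //.
- by move=> i hi; apply: bst => //; apply: pc.
- by move=> i hi; rewrite evalE !(eval_vars _ _ _ _ _ _ m00); lia.
- by rewrite evalE !(eval_vars _ _ _ _ _ _ m00) subnn.
- move=> i hi; apply: (@within_seq _ _ _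
    (layout L m0 [:: n; i; \sum_(0 <= j < i.+1) tf j; 0; 0] (fun=> 0))).
    apply: (within_set m00 b_gt0 (bst _ _ (ltnW hi) (pc _ (ltnW hi))) (isT : 2 < 5)).
    rewrite evalD (@eval_read_low _ _ _ _ _ _ _ _ _ (3 + i)) ?evalE
      ?(eval_vars _ _ _ _ _ _ m00) //; last by lia.
    by rewrite dst_code_flag // big_nat_recr.
  by apply: (within_incr m00) => //; apply: bst; [apply: ltnW | apply: pc].
- by apply: leq_trans hB; rewrite leq_mul2r; apply/orP; right; lia.
Qed.

Lemma within_sum_loop B' : L.+2 * b <= B' ->
  exec_within sum_loop (layout L m0 [:: n; 0; terminal_count; 0; 0] (fun=> 0))
    (layout L m0 [:: n; n * n; terminal_count; num_sum; 0] (fun=> 0)) B'.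
Proof.
move=> hB; have hL := L_lt; have hE := LE; have hc := partial_count_le n.
pose st i := layout L m0 [:: n; i; terminal_count; \sum_(0 <= k < i) nm k; 0] (fun=> 0).
have -> : layout L m0 [:: n; 0; terminal_count; 0; 0] (fun=> 0) = st 0 by rewrite /st big_geq.
have bst i j : i <= n * n -> j <= n * n ->
    bounded b (layout L m0 [:: n; i; terminal_count; \sum_(0 <= k < j) nm k; 0] (fun=> 0)).
  move=> hi hj; apply: low_bounded => //; rewrite ?/terminal_count; try lia.
  by have := partial_sum_lt hj; lia.
apply: (@within_while st (n * n) b) => //.
- by move=> i hi; apply: bst.
- by move=> i hi; rewrite !evalE !(eval_vars _ _ _ _ _ _ m00); lia.
- by rewrite !evalE !(eval_vars _ _ _ _ _ _ m00) subnn.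
- move=> i hi; apply: (@within_seq _ _ _
    (layout L m0 [:: n; i; terminal_count; \sum_(0 <= k < i.+1) nm k; 0] (fun=> 0))).
    apply: (within_set m00 b_gt0 (bst _ _ (ltnW hi) (ltnW hi)) (isT : 3 < 5)).
    rewrite evalD (@eval_entry _ _ _ _ _ _ _ _ m00 _ i) ?(eval_vars _ _ _ _ _ _ m00) //; last by lia.
    by rewrite dst_code_entry // big_nat_recr.
  by apply: (within_incr m00) => //; apply: bst => //; apply: ltnW.
- by apply: leq_trans hB; rewrite leq_mul2r; apply/orP; right; lia.
Qed.

Lemma within_header : exec_within header (St 0) (St 3) b.
Proof.
apply: within_seq; first apply: within_push; first by lia.
  rewrite /cost_end /demand_end !evalE !(eval_vars _ _ _ _ _ _ m00).
  have -> : tgt 0 = size reduction_code by [].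
  by rewrite size_pfct_code; lia.
by apply: within_seq; apply: within_push; rewrite ?(eval_vars _ _ _ _ _ _ m00) //; lia.
Qed.

Lemma within_supply_loop B' : L.+2 * b <= B' ->
  exec_within supply_loop (St 3) (St (3 + n)) B'.
Proof.
move=> hB; have hL := L_lt; have hE := LE.
apply: (@within_while (fun i => St (3 + i)) n b) => //.
- by move=> i hi; apply: St_bounded; lia.
- by move=> i hi; rewrite !evalE !(eval_vars _ _ _ _ _ _ m00); lia.
- by rewrite !evalE !(eval_vars _ _ _ _ _ _ m00) subnn.
- move=> i hi; rewrite addnS; apply: within_push; first by lia.
  rewrite pfct_code_supply // /supply_expr /differ /positive !evalE.
  rewrite (@eval_read_low _ _ _ _ _ _ _ _ _ 2) ?(eval_vars _ _ _ _ _ _ m00) //.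
  rewrite (_ : m0 2 = r) // /pfct_supply addKn; congr (_ + _ * _).
  by case: eqP; lia.
- by apply: leq_trans hB; rewrite leq_mul2r; apply/orP; right; lia.
Qed.

Lemma within_demand_loop B' : L.+2 * b <= B' ->
  exec_within demand_loop (St (3 + n)) (St (3 + 2 * n)) B'.
Proof.
move=> hB; have hL := L_lt; have hE := LE.
have -> : 3 + 2 * n = 3 + n + n by lia.
suff : exec_within demand_loop (St (3 + n + 0)) (St (3 + n + n)) B' by rewrite addn0.
apply: (@within_while (fun i => St (3 + n + i)) n b) => //.
- by move=> i hi; apply: St_bounded; lia.
- by move=> i hi; rewrite !evalE !(eval_vars _ _ _ _ _ _ m00); lia.
- by rewrite !evalE !(eval_vars _ _ _ _ _ _ m00); lia.
- move=> i hi; rewrite addnS; apply: within_push; first by lia.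
  rewrite pfct_code_demand // /demand_expr evalD.
  rewrite (@eval_read_low _ _ _ _ _ _ _ _ _ (3 + i)) ?evalB ?(eval_vars _ _ _ _ _ _ m00) //; try lia.
  by rewrite dst_code_flag.
- by apply: leq_trans hB; rewrite leq_mul2r; apply/orP; right; lia.
Qed.

Lemma within_cost_loop B' : L.+2 * b <= B' ->
  exec_within cost_loop (St (3 + 2 * n)) (St (3 + 2 * n + 2 * (n * n))) B'.
Proof.
move=> hB; have hL := L_lt; have hE := LE.
suff : exec_within cost_loop (St (3 + 2 * n + 2 * 0)) (St (3 + 2 * n + 2 * (n * n))) B'.
  by rewrite muln0 addn0.
apply: (@within_while (fun i => St (3 + 2 * n + 2 * i)) (n * n) b) => //.
- by move=> i hi; apply: St_bounded; lia.
- by move=> i hi; rewrite !evalE !(eval_vars _ _ _ _ _ _ m00); lia.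
- by rewrite !evalE !(eval_vars _ _ _ _ _ _ m00); lia.
- move=> k hk.
  have idx d g : d < 2 -> eval (layout L m0
      [:: n; 3 + 2 * n + 2 * k + d; terminal_count; num_sum; 0] g) cost_index = k.
    by move=> hd; rewrite /cost_index !evalE !(eval_vars _ _ _ _ _ _ m00); lia.
  have -> : 3 + 2 * n + 2 * k.+1 = (3 + 2 * n + 2 * k + 1).+1 by lia.
  apply: (@within_seq _ _ _ (St (3 + 2 * n + 2 * k).+1)).
    apply: within_push; first by lia.
    have := @pfct_code_entry n pfct_supply pfct_demand pfct_num pfct_den k 0 hk isT.
    have {idx} := idx 0; rewrite addn0 => idx ->.
    rewrite /num_expr evalM evalD evalM evalB (@eval_off_diag _ _ _ _ _ _ _ _ m00 _ k) ?idx //.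
    rewrite !(@eval_entry _ _ _ _ _ _ _ _ m00 _ k) ?idx //; try lia.
    by rewrite (eval_fvar _ _ _ _ _ _ m00) !dst_code_entry.
  rewrite -addn1; apply: within_push; first by lia.
  rewrite pfct_code_entry //.
  rewrite /den_expr evalD evalB !evalM !(@eval_off_diag _ _ _ _ _ _ _ _ m00 _ k) ?idx //.
  rewrite !(@eval_entry _ _ _ _ _ _ _ _ m00 _ k) ?idx //; try lia.
  by rewrite !dst_code_entry.
- by apply: leq_trans hB; rewrite leq_mul2r; apply/orP; right; lia.
Qed.

Lemma within_build :
  exec_within build m0
    (layout L m0 [:: n; 3 + 2 * n + 2 * (n * n); terminal_count; num_sum; 0] tgt)
    (L.+2 * b).
Proof.
have hL := L_lt; have hE := LE; have hc := partial_count_le n.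
have le_b : b <= L.+2 * b by rewrite leq_pmull.
have hF : num_sum < 4 * (B * B).
  by have := partial_sum_lt (leqnn _); rewrite -/num_sum; lia.
(* Cells beyond the input hold 0, so the initial memory already is a layout with zero variables and
   an empty copy. *)
have init : m0 = layout L m0 [:: 0; 0; 0; 0; 0] (fun=> 0).
  apply: funext => a; rewrite /layout; case: ifP => // h.
  have -> : m0 a = 0 by rewrite /input_memory nth_default // ltnNge h.
  by case: ifP => // _; case: (a - L.+1) => [|[|[|[|[|[]]]]]].
apply: (@within_seq _ _ _ (layout L m0 [:: n; 0; 0; 0; 0] (fun=> 0))).
  apply: exec_withinW le_b _; rewrite {1}init.
  apply: (within_set m00 b_gt0 _ (isT : 0 < 5)); first by rewrite -init.
  by rewrite (@eval_read_low _ _ _ _ _ _ _ _ _ 1).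
apply: within_seq (within_count_loop (leqnn _)) _.
apply: (@within_seq _ _ _ (layout L m0 [:: n; 0; terminal_count; 0; 0] (fun=> 0))).
  apply: exec_withinW le_b _; apply: (within_reset m00 b_gt0).
  by apply: low_bounded => //; rewrite /terminal_count; move: B hL => x; nia.
apply: within_seq (within_sum_loop (leqnn _)) _.
have -> : tgt = pref (3 + 2 * n + 2 * (n * n)).
  apply: funext => a; rewrite /pref; case: ifP => // h.
  rewrite /input_memory nth_default //.
  have := size_pfct_code n pfct_supply pfct_demand pfct_num pfct_den.
  by rewrite -/reduction_code /= => ->; lia.
apply: (@within_seq _ _ _ (St 0)).
  apply: exec_withinW le_b _.
  have -> : pref 0 = (fun=> 0) by apply: funext.
  apply: (within_reset m00 b_gt0); apply: low_bounded => //; rewrite ?/terminal_count; try lia.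
apply: within_seq; first by apply: exec_withinW le_b _; apply: within_header.
apply: within_seq (within_supply_loop (leqnn _)) _.
apply: within_seq (within_demand_loop (leqnn _)) _.
exact: within_cost_loop.
Qed.

Section Extract.
Variables (g : memory) (b2 : nat).
Hypothesis m0_bounded2 : bounded b2 m0.
Hypothesis g_bounded : bounded b2 g.
Hypothesis num_sum_lt : num_sum < 2 ^ b2.
Hypothesis code_lt : L + 4 < 2 ^ b2.

Definition used_entry (k : nat) : nat :=
  (k %/ n != k %% n) * (1 - (1 - g (1 + 2 * k))).
Definition virtual_count : nat := \sum_(0 <= k < n * n) (1 - fl k) * used_entry k.
Definition selected (k : nat) : nat :=
  fl k * (1 - (1 - (virtual_count + used_entry k))).

Let used_le1 k : used_entry k <= 1.
Proof. by rewrite /used_entry; case: (_ != _); lia. Qed.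

Let partial_virtual_le i : \sum_(0 <= k < i) (1 - fl k) * used_entry k <= i.
Proof.
rewrite -[X in _ <= X]muln1 -[i in X in _ <= X]subn0 -sum_nat_const_nat.
by apply: leq_sum => k _; have := used_le1 k; nia.
Qed.

Let b2_gt0 : 0 < b2.
Proof. by move: code_lt; case: b2 => //; lia. Qed.

Let ext_bounded f i d : bounded b2 f -> i <= L + 4 -> d <= n * n ->
  bounded b2 (layout L f [:: n; i; terminal_count; num_sum; d] g).
Proof.
move=> hf hi hd; have hE := LE; have hc := partial_count_le n; have hl := code_lt.
apply: bounded_layout => //=; rewrite num_sum_lt /=.
by rewrite /terminal_count; apply/and5P; split => //; lia.
Qed.

Let eval_used f i c F d : f 0 = L ->
  eval (layout L f [:: n; i; c; F; d] g) used = used_entry i.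
Proof.
move=> f0; rewrite /used evalM (@eval_off_diag _ _ _ _ _ _ _ _ f0 _ i) ?(eval_vars _ _ _ _ _ _ f0) //.
rewrite /used_entry /positive !evalB !evalC; congr (_ * (_ - (_ - _))).
have -> m : eval m flow = m (eval m (copy_addr (Add (Const 1) (Mul (Const 2) ivar)))) by [].
by rewrite (eval_copy_addr f0) layout_copy !evalE (eval_vars _ _ _ _ _ _ f0).
Qed.

Lemma within_virtual_loop B' : L.+2 * b2 <= B' ->
  exec_within virtual_loop (layout L m0 [:: n; 0; terminal_count; num_sum; 0] g)
    (layout L m0 [:: n; n * n; terminal_count; num_sum; virtual_count] g) B'.
Proof.
move=> hB; have hE := LE.
pose vc i := \sum_(0 <= k < i) (1 - fl k) * used_entry k.
pose st i := layout L m0 [:: n; i; terminal_count; num_sum; vc i] g.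
have -> : layout L m0 [:: n; 0; terminal_count; num_sum; 0] g = st 0 by rewrite /st /vc big_geq.
have bst i j : i <= n * n -> j <= n * n ->
    bounded b2 (layout L m0 [:: n; i; terminal_count; num_sum; vc j] g).
  by move=> hi hj; apply: ext_bounded => //; [lia | apply: leq_trans hj; apply: partial_virtual_le].
apply: (@within_while st (n * n) b2) => //.
- by move=> i hi; apply: bst.
- by move=> i hi; rewrite !evalE !(eval_vars _ _ _ _ _ _ m00); lia.
- by rewrite !evalE !(eval_vars _ _ _ _ _ _ m00) subnn.
- move=> i hi; apply: (@within_seq _ _ _
    (layout L m0 [:: n; i; terminal_count; num_sum; vc i.+1] g)).
    apply: (within_set m00 b2_gt0 (bst _ _ (ltnW hi) (ltnW hi)) (isT : 4 < 5)).
    rewrite evalD evalM evalB evalC eval_used //.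
    rewrite (@eval_entry _ _ _ _ _ _ _ _ m00 _ i)
      ?(eval_vars _ _ _ _ _ _ m00) //; last by lia.
    by rewrite dst_code_entry // /vc big_nat_recr.
  by apply: (within_incr m00) => //; apply: bst => //; apply: ltnW.
- by apply: leq_trans hB; rewrite leq_mul2r; apply/orP; right; lia.
Qed.

(* The flag of entry k is read in cell 3 + n + 3 k > k + 1, hence before it is
   overwritten by the output. *)
Let sel i : memory := fun a => if 0 < a <= i then selected a.-1 else m0 a.

Let sel0 i : sel i 0 = L. Proof. by []. Qed.

Let sel_bounded i : bounded b2 (sel i).
Proof.
move=> a; rewrite /sel; case: ifP => // _; rewrite /selected.
by have := fl_le1 a.-1; have := code_lt; case: (fl _) => [|[|]] //; lia.
Qed.

Lemma within_select_loop B' : L.+2 * b2 <= B' ->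
  exec_within select_loop (layout L m0 [:: n; 0; terminal_count; num_sum; virtual_count] g)
    (layout L (sel (n * n)) [:: n; n * n; terminal_count; num_sum; virtual_count] g) B'.
Proof.
move=> hB; have hE := LE.
pose st i := layout L (sel i) [:: n; i; terminal_count; num_sum; virtual_count] g.
have -> : layout L m0 [:: n; 0; terminal_count; num_sum; virtual_count] g = st 0.
  by congr layout; apply: funext => a; rewrite /sel; case: a.
have bst i j : i <= n * n ->
    bounded b2 (layout L (sel j) [:: n; i; terminal_count; num_sum; virtual_count] g).
  by move=> hi; apply: ext_bounded => //; [lia | apply: partial_virtual_le].
apply: (@within_while st (n * n) b2) => //.
- by move=> i hi; apply: bst.
- by move=> i hi; rewrite !evalE !(eval_vars _ _ _ _ _ _ (sel0 _)); lia.
- by rewrite !evalE !(eval_vars _ _ _ _ _ _ (sel0 _)) subnn.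
- move=> i hi; apply: (@within_seq _ _ _
    (layout L (sel i.+1) [:: n; i; terminal_count; num_sum; virtual_count] g)).
    apply: (@within_write _ _ _ _ _ i.+1 (selected i)) => //; first by apply: bst; apply: ltnW.
    + by rewrite evalE (eval_vars _ _ _ _ _ _ (sel0 _)).
    + rewrite evalM /positive !evalB !evalC evalD eval_used //.
      rewrite (@eval_entry _ _ _ _ _ _ _ _ (sel0 _) _ i)
        ?(eval_vars _ _ _ _ _ _ (sel0 _)) //; last by lia.
      rewrite /sel; case: ifP => [|_]; first by lia.
      by rewrite dst_code_entry.
    rewrite update_layout_low; last by lia.
    congr layout; apply: funext => a; rewrite /update /sel.
    case: eqP => [->|ne]; first by rewrite ltnSn.
    by have -> : (0 < a <= i) = (0 < a <= i.+1) by lia.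
  by apply: (within_incr (sel0 _)) => //; apply: bst => //; apply: ltnW.
- by apply: leq_trans hB; rewrite leq_mul2r; apply/orP; right; lia.
Qed.

(** The counter starts at an arbitrary [i] because [build] leaves its last write position there. *)
Lemma within_extract i : i <= L + 4 ->
  exists2 m', exec_within extract
    (layout L m0 [:: n; i; terminal_count; num_sum; 0] g) m' (L.+2 * b2) &
  output m' = mkseq selected (n * n).
Proof.
move=> hi; have hE := LE.
have le_b : b2 <= L.+2 * b2 by rewrite leq_pmull.
set m1 := layout L (sel (n * n)) [:: n; n * n; terminal_count; num_sum; virtual_count] g.
exists (update m1 0 (n * n)).
  apply: within_seq.
    by apply: exec_withinW le_b _; apply: (within_reset m00) => //; apply: ext_bounded.
  apply: within_seq (within_virtual_loop (leqnn _)) _.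
  apply: within_seq.
    apply: exec_withinW le_b _; apply: (within_reset m00) => //; apply: ext_bounded => //; first by lia.
    exact: partial_virtual_le.
  apply: within_seq (within_select_loop (leqnn _)) _.
  apply: exec_withinW le_b _; apply: (@within_write _ _ _ _ _ 0 (n * n)) => //.
    by apply: ext_bounded => //; [lia | apply: partial_virtual_le].
  by rewrite evalE (eval_vars _ _ _ _ _ _ (sel0 _)).
rewrite /output; have -> : update m1 0 (n * n) 0 = n * n by [].
apply/eq_in_map => k; rewrite mem_iota => /andP[_ hk].
rewrite /update /= /m1 layout_low; last by lia.
by rewrite /sel /= (hk : k < n * n).
Qed.

End Extract.

End Programs.

(** * Running time of the combined program *)

Lemma size_le_code_size s : size s <= code_size s.
Proof. by rewrite -sum1_size /code_size; apply: leq_sum. Qed.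

Lemma code_size_le c s : all (fun v => bits v <= c) s -> code_size s <= size s * c.
Proof.
elim: s => [|v s IHs]; first by rewrite /code_size big_nil.
by move=> /= /andP[hv /IHs hs]; rewrite /code_size big_cons mulSn leq_add.
Qed.

Lemma input_memory_bounded s : bounded (code_size s) (input_memory s).
Proof.
have lt_s : size s < 2 ^ code_size s.
  exact: leq_ltn_trans (size_le_code_size s) (ltn_expl _ _).
apply: bounded_input => //; apply/allP => v hv; apply: leq_trans (bits_lt v) _.
by rewrite leq_exp2l // /code_size (big_rem v) //= leq_addr.
Qed.

Definition dst_of_pfct (p : prog) : prog := Seq build (Seq (reloc p) extract).

(** For input size [x] and PFCT time [t]: building, simulating with the slowdown of relocation,
    extracting from a memory of [2 * x + 2 + t] bits, and the size of the output. *)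
Definition dst_time (t x : nat) : nat :=
  prog_factor build * ((x + 2) * (2 * x + 2)) + 2 * (3 * x + 15) * t +
  prog_factor extract * ((x + 2) * (2 * x + 2 + t)) + x.

Section Reduction.
Variables (n r : nat) (tf fl nm dn : nat -> nat).
Hypothesis r_lt : r < n.
Hypothesis tf_le1 : forall i, tf i <= 1.
Hypothesis fl_le1 : forall k, fl k <= 1.

Local Notation s := (dst_code n r tf fl nm dn).
Local Notation s' := (reduction_code n r tf fl nm dn).
Local Notation X := (code_size s).

(** The PFCT code has at most as many entries as the DST code, two cells per pair against three, and
    each entry has at most [2 * X + 3] bits. *)
Lemma code_size_reduction : code_size s' <= X * (2 * X + 3).
Proof.
have hb := reduction_code_bounded r_lt tf_le1 fl_le1 (@input_memory_bounded s).
apply: leq_trans (@code_size_le (2 * X + 3) _ _) _.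
  apply/(all_nthP 0) => i hi; rewrite addnS; apply: bits_le.
  exact: (hb i.+1).
rewrite leq_mul2r; apply/orP; right; apply: leq_trans (size_le_code_size s).
have : n <= n * n by rewrite leq_pmulr //; lia.
by rewrite size_dst_code size_pfct_code; lia.
Qed.

Lemma dst_of_pfct_runs p o t : runs p s' o t ->
  exists2 g, o = output g &
  exists2 T, runs (dst_of_pfct p) s (mkseq (selected n fl g) (n * n)) T &
             T <= dst_time t X.
Proof.
move=> [g [t' [exp -> et]]]; exists g => //.
have bX := @input_memory_bounded s.
have hb := reduction_code_bounded r_lt tf_le1 fl_le1 bX.
have lt_nn : n <= n * n by rewrite leq_pmulr //; lia.
have lt_t : t' <= t by rewrite et leq_addr.
have hL := size_le_code_size s; have hE := size_dst_code n r tf fl nm dn.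
have powX : X < 2 ^ X by apply: ltn_expl.
have pow2 : 2 ^ (2 * X + 2) = 4 * (2 ^ X * 2 ^ X).
  by rewrite expnD mulnC mul2n -addnn expnD.
have [t1 ex1 le1] := within_build r_lt tf_le1 fl_le1 bX.
set vs := [:: _; _; _; _; _] in ex1.
have f0 : input_memory s 0 = size s by [].
have [t2 ex2 le2] := exec_reloc vs f0 exp.
have hb2 := exec_bounded exp hb.
have powle : 2 ^ (2 * X + 2) <= 2 ^ (2 * X + 2 + t') by rewrite leq_exp2l // leq_addr.
have [||||m' [t3 ex3 le3] eo] := @within_extract _ _ _ _ _ _ _ r_lt tf_le1 fl_le1 bX
  g (2 * X + 2 + t') _ hb2 _ _ (3 + 2 * n + 2 * (n * n)).
- by apply: boundedW bX; lia.
- apply: leq_trans powle; rewrite pow2.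
  have := partial_sum_le bX (leqnn _).
  rewrite -/(num_sum n nm); move: (2 ^ X) powX => y; nia.
- by apply: leq_trans powle; rewrite pow2; move: (2 ^ X) powX => y; nia.
- by lia.
exists (t1 + (t2 + t3) + code_size (mkseq (selected n fl g) (n * n))).
  exists m', (t1 + (t2 + t3)); split => //.
  by apply: ExecSeq ex1 _; apply: ExecSeq ex2 ex3.
rewrite /dst_time; apply: leq_add; last first.
  (* The output consists of [n * n] flags of one bit each, fewer than the entries of the input. *)
  apply: leq_trans (@code_size_le 1 _ _) _; last by rewrite size_mkseq; lia.
  rewrite all_map; apply/allP => k _ /=; rewrite /selected.
  by have := fl_le1 k; case: (fl k) => [|[|]] // _; rewrite mul1n; case: (_ + _).
rewrite -addnA !leq_add //.
- apply: leq_trans le1 _; rewrite leq_mul2l; apply/orP; right.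
  by rewrite leq_mul2r; apply/orP; right; lia.
- apply: leq_trans le2 _; apply: leq_mul => //; rewrite leq_mul2l; apply/orP; right.
  rewrite /addr_overhead; have := bitsD (size s) 6.
  have : bits (size s) <= X.+1 by apply: bits_le; lia.
  have -> : bits 0 = 1 by []. have -> : bits 6 = 3 by [].
  by lia.
- apply: leq_trans le3 _; rewrite leq_mul2l; apply/orP; right.
  by apply: leq_mul; lia.
Qed.

End Reduction.

Lemma dst_time_poly c k :
  poly_bounded (fun x => dst_time (c * (x * (2 * x + 3)) ^ k + c) x).
Proof.
have pC := poly_bounded_const; have pI := poly_bounded_id.
have pl a d : poly_bounded (fun x => a * x + d).
  by apply: poly_boundedD => //; apply: poly_boundedM.
have pa d : poly_bounded (fun x => x + d) by apply: poly_boundedD.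
have pt : poly_bounded (fun x => c * (x * (2 * x + 3)) ^ k + c).
  apply: poly_boundedD => //; apply: poly_boundedM => //.
  by apply: poly_boundedX; apply: poly_boundedM.
rewrite /dst_time; apply: poly_boundedD => //.
apply: poly_boundedD; last first.
  apply: poly_boundedM => //; apply: poly_boundedM => //; exact: poly_boundedD.
apply: poly_boundedD.
  by apply: poly_boundedM => //; apply: poly_boundedM.
by apply: poly_boundedM => //; apply: poly_boundedM.
Qed.
Local Open Scope ring_scope.

(** * The reduction *)

Section Walk.
Variables (R : realType) (n : nat).
Implicit Types (u v i j : 'I_n) (p : seq 'I_n).

(* Each step (u, v) of the walk ships one unit from source u to sink v and
   removes one unit from source v to sink v: columns are unchanged, and the
   row sums telescope. *)
Fixpoint walk_flow u p i j : R :=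
  if p is v :: p' then
    ((i == u) && (j == v))%:R - ((i == v) && (j == v))%:R + walk_flow v p' i j
  else 0.

Lemma sum_indicator_row i u v : \sum_j ((i == u) && (j == v))%:R = (i == u)%:R :> R.
Proof.
by rewrite (bigD1 v) //= big1 => [|j /negbTE ->]; rewrite ?eqxx andbC ?addr0.
Qed.

Lemma sum_indicator_col j u v : \sum_i ((i == u) && (j == v))%:R = (j == v)%:R :> R.
Proof.
by rewrite (bigD1 u) //= big1 => [|i /negbTE ->]; rewrite ?eqxx ?addr0.
Qed.

Lemma walk_flow_row u p i : \sum_j walk_flow u p i j = (i == u)%:R - (i == last u p)%:R.
Proof.
elim: p u => [|v p IHp] u /=; first by rewrite subrr big1.
by rewrite !big_split /= IHp sumrN !sum_indicator_row addrA subrK.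
Qed.

Lemma walk_flow_col u p j : \sum_i walk_flow u p i j = 0.
Proof.
elim: p u => [|v p IHp] u /=; first by rewrite big1.
by rewrite !big_split /= IHp sumrN !sum_indicator_col subrr addr0.
Qed.

(** Units are removed on the diagonal only. Off it, just the steps of the walk from [i] to [j]
    contribute, one unit each. *)
Lemma walk_flow_off_diag (e : rel 'I_n) u p i j : path e u p -> i != j ->
  0 <= walk_flow u p i j /\ (0 < walk_flow u p i j -> e i j).
Proof.
elim: p u => [|v p IHp] u /=; first by rewrite ltxx.
move=> /andP[euv /IHp h] ne; have [h0 he] := h ne.
have -> : (i == v) && (j == v) = false.
  by apply/negbTE; apply: contra ne => /andP[/eqP-> /eqP->].
rewrite subr0; case: andP => [[/eqP iu /eqP jv]|_]; last by rewrite add0r.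
by split=> [|_]; [rewrite addr_ge0 | rewrite iu jv].
Qed.

Lemma walk_flow_diag u p j : - (count_mem j p)%:R <= walk_flow u p j j.
Proof.
elim: p u => [|v p IHp] u /=; first by rewrite oppr0.
rewrite andbb natrD opprD eq_sym lerD //.
by rewrite lerDr ler0n.
Qed.

(** Repairs [walk_flow]: a unit on the whole diagonal pays for the removals along a simple path, and
    a further one at the endpoint cancels the -1 in its row and provides the +1 in its column. *)
Definition path_matrix r p i j : R :=
  (i == j)%:R + ((i == last r p) && (j == last r p))%:R + walk_flow r p i j.

Lemma sum_eq_row i : \sum_j (i == j)%:R = 1 :> R.
Proof. by rewrite (bigD1 i) //= eqxx big1 ?addr0 // => j; rewrite eq_sym => /negbTE->. Qed.

Lemma sum_eq_col j : \sum_i (i == j)%:R = 1 :> R.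
Proof. by rewrite (bigD1 j) //= eqxx big1 ?addr0 // => i /negbTE->. Qed.

Lemma path_matrix_row r p i : \sum_j path_matrix r p i j = 1 + (i == r)%:R.
Proof.
by rewrite !big_split /= walk_flow_row sum_indicator_row sum_eq_row; lra.
Qed.

Lemma path_matrix_col r p j : \sum_i path_matrix r p i j = 1 + (j == last r p)%:R.
Proof.
by rewrite !big_split /= walk_flow_col sum_indicator_col sum_eq_col addr0.
Qed.

Lemma path_matrix_ge0 (e : rel 'I_n) r p i j : path e r p -> uniq p ->
  0 <= path_matrix r p i j.
Proof.
move=> er up; rewrite /path_matrix; have [<-|ne] := eqVneq i j.
  have := walk_flow_diag r p i; rewrite count_uniq_mem // -[true%:R]/1 => h.
  have : ((i \in p)%:R : R) <= 1 by rewrite lern1 leq_b1.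
  have : 0 <= (((i == last r p) && (i == last r p))%:R : R) by rewrite ler0n.
  by lra.
by rewrite add0r addr_ge0 ?ler0n //; case: (walk_flow_off_diag er ne).
Qed.

Lemma path_matrix_gt0 (e : rel 'I_n) r p i j : path e r p -> i != j ->
  0 < path_matrix r p i j -> e i j.
Proof.
move=> er ne; rewrite /path_matrix (negbTE ne) add0r.
have -> : (i == last r p) && (j == last r p) = false.
  by apply/negbTE; apply: contra ne => /andP[/eqP-> /eqP->].
by rewrite add0r; case: (walk_flow_off_diag er ne).
Qed.

End Walk.

(** * The PFCT instance of a DST instance and the transfer of solutions *)

Section Reduction.
Variables (R : realType) (I : dst_instance R) (W : nat).
Local Notation n := (vertices I).
Local Notation r := (root_vertex I).
Local Notation T := (terminals I).
Local Notation E := (edges I).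

Definition red_supply (u : 'I_n) : nat := (n + (u == r) * #|T|)%N.
Definition red_demand (v : 'I_n) : nat := (n + (v \in T))%N.
Definition red_cost (u v : 'I_n) : R :=
  if u == v then 0 else if (u, v) \in E then edge_cost (u, v) else W%:R.

Lemma vertices_gt0 : (0 < n)%N.
Proof. exact: leq_ltn_trans (ltn_ord r). Qed.

Lemma red_supply_gt0 u : (0 < red_supply u)%N.
Proof. by rewrite addn_gt0 vertices_gt0. Qed.

Lemma red_demand_gt0 v : (0 < red_demand v)%N.
Proof. by rewrite addn_gt0 vertices_gt0. Qed.

Lemma red_supply_demand : (\sum_u red_supply u = \sum_v red_demand v)%N.
Proof.
rewrite !big_split /=; congr (_ + _)%N.
rewrite -big_distrl /= (bigD1 r) //= eqxx big1 => [|u /negbTE->] //.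
by rewrite addn0 mul1n -sum1_card big_mkcond; apply: eq_bigr => v _; case: (_ \in _).
Qed.

Lemma red_cost_ge0 u v : 0 <= red_cost u v.
Proof.
by rewrite /red_cost; case: ifP => // _; case: ifP => [/edge_cost_ge0//|_]; rewrite ler0n.
Qed.

Definition red_instance : pfct_instance R :=
  @PFCTInstance R n n red_supply red_demand red_cost vertices_gt0 vertices_gt0
    red_supply_gt0 red_demand_gt0 red_supply_demand red_cost_ge0.

Lemma pfct_of_dst (H : {set 'I_n * 'I_n}) : @dst_feasible R I H ->
  exists2 x : 'M[R]_(n, n), @pfct_feasible R red_instance x &
    @pfct_cost R red_instance x <= @dst_cost R I H.
Proof.
move=> [sHE con]; pose e : rel 'I_n := fun u v => (u, v) \in H.
have /choice[P hP] : forall t, exists p, t \in T -> [/\ path e r p, uniq p & t = last r p].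
  move=> t; have [tT|_] := boolP (t \in T); last by exists [::].
  have /connectP[p ep ->] := con t tT.
  by case/shortenP: ep => p' ep' /= /andP[_ up'] _; exists p'.
(* Each of the [#|T|] path matrices uses one unit of the base amount [n] of every row and column.
   The remaining [n - #|T|] units go along the diagonal for free. *)
pose x := \matrix_(i, j) (\sum_(t in T) path_matrix R r (P t) i j
  + (n - #|T|)%:R * (i == j)%:R) : 'M[R]_(n, n).
have leT : (#|T| <= n)%N by rewrite -[X in (_ <= X)%N]card_ord max_card.
have x_ge0 i j : 0 <= x i j.
  rewrite mxE addr_ge0 ?mulr_ge0 ?ler0n // sumr_ge0 // => t /hP[ep up _].
  exact: path_matrix_ge0 ep up.
(* A positive off-diagonal entry comes from some path matrix, hence from an edge of [H]; this gives
   the cost bound. *)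
have x_gt0 i j : i != j -> 0 < x i j -> e i j.
  move=> ne; rewrite mxE (negbTE ne) mulr0 addr0 => h.
  apply: contraT => nee; suff : \sum_(t in T) path_matrix R r (P t) i j <= 0.
    by rewrite leNgt h.
  apply: sumr_le0 => t /hP[ep _ _]; rewrite leNgt; apply: contra nee.
  exact: path_matrix_gt0 ep ne.
exists x.
  split=> //= [i|j].
  - under eq_bigr do rewrite mxE.
    rewrite big_split /= exchange_big /= -big_distrr /= sum_eq_row mulr1.
    under eq_bigr do rewrite path_matrix_row.
    rewrite sumr_const /red_supply natrD natrM natrB // -mulr_natr; lra.
  - under eq_bigr do rewrite mxE.
    rewrite big_split /= exchange_big /= -big_distrr /= sum_eq_col mulr1.
    under eq_bigr do rewrite path_matrix_col.
    rewrite big_split /= sumr_const /red_demand natrD natrB //.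
    have -> : \sum_(t in T) (j == last r (P t))%:R = (j \in T)%:R :> R.
      rewrite (eq_bigr (fun t => (j == t)%:R)) => [|t /hP[_ _ <-]] //.
      have [jT|jT] := boolP (j \in T).
        rewrite (bigD1 j) //= eqxx big1 ?addr0 // => t /andP[_].
        by rewrite eq_sym => /negbTE->.
      by rewrite big1 // => t tT; case: eqP jT => // ->; rewrite tT.
    by lra.
rewrite /pfct_cost /dst_cost pair_bigA /= [leRHS]big_mkcond /=.
apply: ler_sum => -[i j] _ /=.
have H_ge0 : 0 <= if (i, j) \in H then edge_cost (i, j) else 0.
  by case: ifP => // ijH; apply: edge_cost_ge0; apply: (subsetP sHE).
case: ifP => // xij; rewrite /red_cost; case: eqP => [//|/eqP ne].
have ijH : (i, j) \in H := x_gt0 i j ne xij.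
by rewrite ijH (subsetP sHE _ ijH).
Qed.

Section Recovery.
Variable x : 'M[R]_(n, n).
Hypothesis x_feasible : @pfct_feasible R red_instance x.

(* The sinks outside the set S of reachable vertices are only served by sources
   outside S, whose total supply is exhausted by the demand n of each of them. *)
Lemma terminal_reachable t : t \in T ->
  connect (fun u v => (u != v) && (0 < x u v)) r t.
Proof.
case: x_feasible => /= x_ge0 rows cols tT; apply: contraT => nct.
pose e : rel 'I_n := fun u v => (u != v) && (0 < x u v).
pose U := [set v | ~~ connect e r v].
have tU : t \in U by rewrite inE.
have cut v : v \in U -> \sum_i x i v = \sum_(i in U) x i v.
  rewrite inE => ncv; rewrite [RHS]big_mkcond; apply: eq_bigr => i _.
  rewrite inE; case: ifPn => // /negPn ci; apply/eqP.
  rewrite eq_le x_ge0 andbT leNgt; apply: contra ncv => xiv.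
  have [<-//|ne] := eqVneq i v.
  by apply: connect_trans ci (connect1 _); rewrite /e ne.
have : (\sum_(v in U) red_demand v)%N%:R <= (\sum_(u in U) red_supply u)%N%:R :> R.
  rewrite !natr_sum -(eq_bigr _ (fun v _ => cols v)) -(eq_bigr _ (fun u _ => rows u)).
  rewrite (eq_bigr _ cut) exchange_big /=; apply: ler_sum => u _.
  by rewrite [leLHS]big_mkcond /=; apply: ler_sum => v _; case: ifP.
rewrite ler_nat leqNgt => /negP[].
rewrite (bigD1 t) //= [X in (_ < X)%N](bigD1 t) //=.
have supU u : u \in U -> red_supply u = n.
  rewrite inE /red_supply => ncu; case: eqP ncu => [->|_ _]; last by rewrite addn0.
  by rewrite connect0.
rewrite supU // /red_demand tT addn1 -addnS addSn addnS ltnS leq_add2l.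
by apply: leq_sum => u /andP[uU _]; rewrite supU // leq_addr.
Qed.

Definition uses_non_edge : bool :=
  [exists u, exists v, [&& u != v, (u, v) \notin E & 0 < x u v]].

Definition selected_edges : {set 'I_n * 'I_n} :=
  [set e in E | uses_non_edge || (e.1 != e.2) && (0 < x e.1 e.2)].

(** If a non-edge is used, all edges are kept and the given solution [H] lies among them. Otherwise
    every off-diagonal support pair is an edge, and [terminal_reachable] applies. *)
Lemma selected_edges_feasible : (exists H, @dst_feasible R I H) ->
  @dst_feasible R I selected_edges.
Proof.
move=> [H [sHE con]]; split; first by apply/subsetP => e; rewrite inE => /andP[].
move=> t tT; have [bad|good] := boolP uses_non_edge.
  apply: connect_sub (con t tT) => u v uvH; apply: connect1.
  by rewrite inE bad andbT (subsetP sHE).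
apply: connect_sub (terminal_reachable tT) => u v /andP[ne xuv]; apply: connect1.
rewrite inE ne xuv orbT andbT.
move: good; rewrite negb_exists => /forallP/(_ u); rewrite negb_exists => /forallP/(_ v).
by rewrite ne xuv andbT /= negbK.
Qed.

(** A single non-edge in use costs [W], which pays for all of [E]. Otherwise each selected edge is
    charged to its own support entry. *)
Lemma selected_edges_cost : \sum_(e in E) edge_cost e <= W%:R ->
  @dst_cost R I selected_edges <= @pfct_cost R red_instance x.
Proof.
move=> leW; rewrite /dst_cost /pfct_cost pair_bigA /=.
have term_ge0 (u v : 'I_n) : 0 <= if 0 < x u v then red_cost u v else 0.
  by case: ifP => // _; apply: red_cost_ge0.
have [bad|good] := boolP uses_non_edge.
  have -> : selected_edges = E by apply/setP => e; rewrite inE bad andbT.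
  apply: le_trans leW _; move: bad => /existsP[u /existsP[v /and3P[ne nE xuv]]].
  rewrite (bigD1 (u, v)) //= xuv {1}/red_cost (negbTE ne) (negbTE nE).
  by rewrite lerDl sumr_ge0 // => -[].
rewrite big_mkcond; apply: ler_sum => -[u v] _ /=.
rewrite inE /= (negbTE good) /=; case: ifP => // /and3P[uvE ne xuv].
by rewrite xuv /red_cost (negbTE ne) uvE.
Qed.

End Recovery.

(** There are only finitely many edge sets, so the minimum is attained. *)
Lemma dst_optimum : (exists H, @dst_feasible R I H) ->
  exists opt, @is_optimum R (DST R) I opt.
Proof.
move=> [H0 f0]; pose P (H : {set 'I_n * 'I_n}) := `[< @dst_feasible R I H >].
have P0 : P H0 by apply/asboolP.
have [H /asboolP fH minH] := Order.TotalTheory.arg_minP (fun H => @dst_cost R I H) P0.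
exists (@dst_cost R I H); split; first by exists H.
by move=> H' fH'; apply: minH; apply/asboolP.
Qed.

End Reduction.

(** * Correctness of the translation *)

Lemma map_enum_mkseq (T : Type) n (F : 'I_n -> T) (G : nat -> T) :
  (forall i : 'I_n, F i = G i) -> [seq F i | i <- enum 'I_n] = mkseq G n.
Proof. by move=> h; rewrite /mkseq -val_enum_ord -map_comp; apply: eq_map. Qed.

Lemma mkseq_mul (T : Type) (G : nat -> T) m n :
  mkseq G (m * n) = flatten (mkseq (fun u => mkseq (fun v => G (u * n + v)%N) n) m).
Proof.
elim: m => [|m IHm] //; rewrite mkseqS flatten_rcons -IHm mulSn addnC /mkseq iotaD map_cat.
by rewrite add0n -[X in iota X n]addn0 iotaDl -map_comp.
Qed.

Lemma allpairs_enum_mkseq (T : Type) n (F : 'I_n -> 'I_n -> T) (G : nat -> T) :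
  (forall u v : 'I_n, F u v = G (u * n + v)%N) ->
  [seq F u v | u <- enum 'I_n, v <- enum 'I_n] = mkseq G (n * n).
Proof.
move=> h; rewrite mkseq_mul; congr flatten; apply: map_enum_mkseq => u.
exact: map_enum_mkseq.
Qed.

Section Assembly.
Variables (R : realType) (I : dst_instance R).
Local Notation n := (vertices I).
Local Notation r := (root_vertex I).
Local Notation T := (terminals I).
Local Notation E := (edges I).
Variables num den : 'I_n -> 'I_n -> nat.
Hypothesis fracE : forall u v, (u, v) \in E ->
  is_fraction (edge_cost (u, v)) (num u v) (den u v).

(** Out-of-range indices default to the root; the codes only evaluate indices below [n]. *)
Let vtx (i : nat) : 'I_n := insubd r i.
Let row (k : nat) : 'I_n := vtx (k %/ n).
Let col (k : nat) : 'I_n := vtx (k %% n).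

Definition tflag (i : nat) : nat := vtx i \in T.
Definition eflag (k : nat) : nat := (row k, col k) \in E.
Definition edge_num (k : nat) : nat := if (row k, col k) \in E then num (row k) (col k) else 0%N.
Definition edge_den (k : nat) : nat := if (row k, col k) \in E then den (row k) (col k) else 0%N.

Let vtxK (u : 'I_n) : vtx u = u. Proof. exact: valKd. Qed.
Let div_pair (u v : 'I_n) : ((u * n + v) %/ n)%N = u.
Proof. by rewrite divnMDl ?vertices_gt0 // divn_small ?addn0. Qed.
Let mod_pair (u v : 'I_n) : ((u * n + v) %% n)%N = v.
Proof. by rewrite modnMDl modn_small. Qed.
Let rowE (u v : 'I_n) : row (u * n + v) = u. Proof. by rewrite /row div_pair vtxK. Qed.
Let colE (u v : 'I_n) : col (u * n + v) = v. Proof. by rewrite /col mod_pair vtxK. Qed.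
Let pair_lt (u v : 'I_n) : (u * n + v < n * n)%N.
Proof. by have := ltn_ord u; have := ltn_ord v; nia. Qed.

Lemma dst_codeE :
  [:: n; nat_of_ord r]
    ++ [seq nat_of_bool (v \in T) | v <- enum 'I_n]
    ++ flatten [seq if (u, v) \in E then [:: 1%N; num u v; den u v] else [:: 0%N; 0%N; 0%N]
               | u <- enum 'I_n, v <- enum 'I_n]
  = dst_code n r tflag eflag edge_num edge_den.
Proof.
rewrite /dst_code (@map_enum_mkseq _ _ _ tflag) => [|i]; last by rewrite /tflag vtxK.
congr (_ ++ (_ ++ flatten _)); apply: allpairs_enum_mkseq => u v.
by rewrite /eflag /edge_num /edge_den rowE colE; case: (_ \in _).
Qed.

Local Notation W := (num_sum n edge_num).

Lemma num_sumE : W = (\sum_u \sum_v (if (u, v) \in E then num u v else 0))%N.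
Proof.
rewrite /num_sum /index_iota subn0 -(big_map edge_num predT (fun x => x)) -/(mkseq _ _).
rewrite -(@allpairs_enum_mkseq _ _ (fun u v => if (u, v) \in E then num u v else 0%N)).
  by rewrite big_allpairs_dep big_enum; apply: eq_bigr => u _; rewrite big_enum.
by move=> u v; rewrite /edge_num rowE colE.
Qed.

(** A fraction with denominator at least 1 is at most its numerator. The sum of the numerators thus
    serves as [W], and no common denominator has to be computed. *)
Lemma total_cost_le : \sum_(e in E) edge_cost e <= W%:R.
Proof.
rewrite num_sumE pair_bigA natr_sum big_mkcond; apply: ler_sum => -[u v] _ /=.
case: ifP => // /fracE[den_gt0 ->].
rewrite ler_pdivrMr ?ltr0n // -natrM ler_nat; exact: leq_pmulr.
Qed.

Lemma terminal_countE : terminal_count n tflag = #|T|.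
Proof.
rewrite /terminal_count big_mkord -sum1_card [RHS]big_mkcond; apply: eq_bigr => i _.
by rewrite /tflag vtxK; case: (_ \in _).
Qed.

Local Notation J := (red_instance I W).

Lemma red_instance_coded :
  pfct_codes_instance (reduction_code n r tflag eflag edge_num edge_den) J.
Proof.
pose pn := pfct_num n eflag edge_num; pose pd := pfct_den n eflag edge_den.
exists (fun u v : 'I_n => pn (u * n + v)%N), (fun u v : 'I_n => pd (u * n + v)%N); split=> [u v|] /=.
  rewrite /pn /pd /pfct_num /pfct_den /eflag /edge_num /edge_den /red_cost.
  (* Three cases: 0/1 on the diagonal, the given fraction at an edge, and [W]/1 at a non-edge. *)
  rewrite div_pair mod_pair rowE colE val_eqE; have [_|_] := eqVneq u v.
    by split; rewrite // mul0r.
  case: ifP => [/fracE[den_gt0 ->]|_] /=.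
    by rewrite !mul1n subnn mul0n !addn0; split.
  by split; rewrite // !(mul1n, muln0, add0n, subn0) divr1.
rewrite /reduction_code /pfct_code; congr [:: _, _ & _].
rewrite (@map_enum_mkseq _ _ _ (pfct_supply n r tflag)) => [|u]; last first.
  by rewrite /= /red_supply /pfct_supply terminal_countE val_eqE.
rewrite (@map_enum_mkseq _ _ _ (pfct_demand n tflag)) => [|v]; last first.
  by rewrite /= /red_demand /pfct_demand /tflag vtxK.
by congr (_ ++ (_ ++ flatten _)); apply: esym; apply: allpairs_enum_mkseq.
Qed.

Lemma selected_coded (x : 'M[R]_(n, n)) (g : memory) :
  @pfct_codes_solution R J (output g) x ->
  @dst_codes_solution R I (mkseq (selected n eflag g) (n * n)) (selected_edges x).
Proof.
move=> [xn [xd [fx]]] /=.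
rewrite (@allpairs_enum_mkseq _ _ _ (fun k => [:: xn (row k) (col k); xd (row k) (col k)])); last first.
  by move=> u v; rewrite rowE colE.
(* Comparing lengths determines cell 0 of [g]; only then do entries of the code identify cells of
   [g]. *)
move=> og; have size_g : g 0%N = (n * n * 2)%N.
  by rewrite -(size_mkseq (fun i => g i.+1) (g 0%N)) [mkseq _ _]og (@size_flatten_mkseq _ _ 2).
have gE (u v : 'I_n) : g (1 + 2 * (u * n + v))%N = xn u v.
  have := @nth_flatten_mkseq _ 0%N (fun k => [:: xn (row k) (col k); xd (row k) (col k)])
    2 (n * n) (u * n + v) 0 (fun=> erefl) (pair_lt u v) isT.
  rewrite -og nth_mkseq ?size_g; last by have := pair_lt u v; lia.
  by rewrite /= rowE colE addn0 mulnC.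
have x_gt0 u v : (0 < x u v) = (0 < xn u v)%N.
  by have [den_gt0 ->] := fx u v; rewrite pmulr_lgt0 ?invr_gt0 ltr0n.
have usedE (u v : 'I_n) : used_entry n g (u * n + v) = (u != v) && (0 < x u v).
  rewrite /used_entry div_pair mod_pair val_eqE gE x_gt0.
  by case: (u != v) => //=; case: (xn u v) => //= m; lia.
have virtE : (0 < virtual_count n eflag g)%N = uses_non_edge x.
  apply/idP/existsP => [|[u /existsP[v /and3P[ne nE xuv]]]].
    rewrite lt0n /virtual_count big_mkord sum_nat_eq0 negb_forall => /existsP[k].
    have lt_row : (k %/ n < n)%N by rewrite ltn_divLR ?vertices_gt0.
    have lt_col : (k %% n < n)%N by rewrite ltn_mod vertices_gt0.
    have -> : nat_of_ord k = (Ordinal lt_row * n + Ordinal lt_col)%N by apply: divn_eq.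
    move: (Ordinal lt_row) (Ordinal lt_col) => u v.
    rewrite /= muln_eq0 negb_or => /andP[]; rewrite usedE /eflag rowE colE.
    case: (boolP (_ \in E)) => // nE _ h; exists u; apply/existsP; exists v.
    by rewrite nE; move: h; case: (_ && _).
  rewrite /virtual_count big_mkord (bigD1 (Ordinal (pair_lt u v))) //= usedE ne xuv.
  by rewrite /eflag rowE colE (negbTE nE).
rewrite /dst_codes_solution; apply/esym; apply: allpairs_enum_mkseq => u v.
rewrite /selected /eflag rowE colE usedE inE /= -virtE.
case: (_ \in E) => //=; rewrite mul1n.
by case: (virtual_count _ _ _) => [|m] /=; case: (_ && _) => /=; lia.
Qed.

End Assembly.

Lemma leq_dst_time t t' x : (t <= t')%N -> (dst_time t x <= dst_time t' x)%N.
Proof.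
move=> le_t; rewrite /dst_time leq_add2r; apply: leq_add.
  by rewrite leq_add2l leq_mul2l le_t orbT.
by rewrite leq_mul2l; apply/orP; right; rewrite leq_mul2l leq_add2l le_t orbT.
Qed.

Theorem theorem1p4 (R : realType) (alpha : nat -> R)
  (alpha_gt0 : forall k : nat, (0 < k)%N -> 0 < alpha k)
  (alpha_mono : forall k l : nat, (0 < k)%N -> (k <= l)%N -> alpha k <= alpha l) :
  has_polytime_approximation
    (fun I : instance (PFCT R) => alpha (maxn (sources I) (sinks I))) ->
  has_polytime_approximation
    (fun I : instance (DST R) => alpha (vertices I)).
Proof.
move=> [p [c [k p_ok]]]; have [c' [k' time_le]] := dst_time_poly c k.
exists (dst_of_pfct p), c', k' => I s [num [den [fracE ->]]].
rewrite dst_codeE; set tf := tflag I; set fl := eflag I.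
set nm := edge_num num; set dn := edge_den den; set s' := dst_code _ _ _ _ _ _.
have r_lt : (root_vertex I < vertices I)%N := ltn_ord _.
have tf_le1 i : (tf i <= 1)%N by apply: leq_b1.
have fl_le1 i : (fl i <= 1)%N by apply: leq_b1.
pose W := num_sum (vertices I) nm; pose J := red_instance I W.
have [o [t [run_p t_le p_apx]]] := p_ok J _ (red_instance_coded fracE).
have [g og [T run_T T_le]] := dst_of_pfct_runs r_lt tf_le1 fl_le1 run_p.
exists (mkseq (selected (vertices I) fl g) (vertices I * vertices I)), T; split=> //.
  apply: leq_trans T_le (leq_trans (leq_dst_time _ _) (time_le _)).
  apply: leq_trans t_le _; rewrite leq_add2r leq_mul2l; apply/orP; right.
  have le_s := code_size_reduction nm dn r_lt tf_le1 fl_le1.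
  by case: {+}k => [|l] //; rewrite leq_exp2r.
move=> feasible_I; have [opt [[H [fH costH]] opt_le]] := dst_optimum feasible_I.
have [y fy cost_y] := pfct_of_dst W fH.
(* The guarantee for the PFCT algorithm presupposes a feasible transportation, and [y] is one. *)
have [|x [o_x fx [optJ [_ optJ_le] cost_x]]] := p_apx; first by exists y.
exists (selected_edges x); split.
- by apply: (@selected_coded _ _ num); rewrite -og.
- exact: selected_edges_feasible fx feasible_I.
exists opt; first by split=> //; exists H.
apply: le_trans (selected_edges_cost x (total_cost_le fracE)) _.
(* With [n] sources and [n] sinks the two ratios coincide, and it remains to compare optima: [optJ]
   is at most the cost of [y], hence at most that of the optimal [H]. *)
apply: le_trans cost_x _; rewrite /= maxnn ler_pM2l; last exact: alpha_gt0 (vertices_gt0 I).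
by apply: le_trans (optJ_le _ fy) _; rewrite -costH.
Qed.
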